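(* (i) Let $1\le p<2$ and $p/2\le s<1$. Then $L_p$ equipped with the metric $\|f-g\|_{L_p}^{s}$ embeds isometrically into $L_p$ (with its norm metric). (ii) For all $0<s<1$, $L_1$ equipped with the metric $\|f-g\|_{L_1}^{s}$ embeds isometrically into $L_1$ (with its norm metric). (iii) For $0<p<1$ and all $0<s<1$, $(L_p,d_p^{s})$ embeds isometrically into $(L_p,d_p)$.
   Context: $L_p=L_p[0,1]$ (real). For $0<p\le 1$, $d_p(f,g)=\int_0^1|f(t)-g(t)|^p\,dt$ is the metric on $L_p$; for $p\ge1$, $L_p$ carries its norm metric. For a metric $d$, $d^s$ denotes $(x,y)\mapsto d(x,y)^s$. An isometric embedding is a (not necessarily linear) distance-preserving map. *)

(* Defs.v *)
From HB Require Import structures.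
From mathcomp Require Import all_boot all_order all_algebra.
From mathcomp Require Import all_classical all_reals all_analysis.
Set Implicit Arguments.
Unset Strict Implicit.
Unset Printing Implicit Defensive.
Import Order.TTheory GRing.Theory Num.Theory.
Local Open Scope classical_set_scope.
Local Open Scope ring_scope.

Section metric_embeddings.
Context {R : realType}.

Definition snowflake {X : Type} (dX : X -> X -> R) (s : R) : X -> X -> R :=
  fun x y => dX x y `^ s.

Definition isometry {X Y : Type} (dX : X -> X -> R) (dY : Y -> Y -> R)
    (h : X -> Y) : Prop :=
  forall x y, dY (h x) (h y) = dX x y.

Definition embeds_isometrically {X Y : Type} (dX : X -> X -> R)
    (dY : Y -> Y -> R) : Prop :=
  exists h : X -> Y, isometry dX dY h.

End metric_embeddings.

(* L_p[0,1] is taken over the real line with Lebesgue measure restricted to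
   [0,1]: the complement of [0,1] is negligible, so classes of measurable
   functions modulo a.e. equality are classes of functions on [0,1]. *)
Definition lebesgue01 (R : realType) : set (measurableTypeR R) -> \bar R :=
  mrestr (@lebesgue_measure R) (measurable_itv `[(0 : R), 1]).
Arguments lebesgue01 : clear implicits.
HB.instance Definition _ (R : realType) := Measure.on (lebesgue01 R).

Section Lp_metrics.
Context d {T : measurableType d} {R : realType}.
Variable mu : {measure set T -> \bar R}.

(* In the next three definitions a class f is applied to a point through its
   canonical representative; integrals do not depend on that choice. *)
Definition Lnorm_dist (p : R) (p1 : (1 <= p%:E)%E)
    (f g : LspaceType mu p1) : R :=
  fine ('N[mu]_(p%:E) [EFin \o (fun x => f x - g x : R)%R])%E.

(* LspaceType requires 1 <= p, hence this version for p < 1. *)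
Definition Lp_lt1 (p : R) : set {mfun_ mu, T >-> measurableTypeR R} :=
  [set f : {mfun_ mu, T >-> measurableTypeR R} |
    (\int[mu]_x (`|f x| `^ p)%:E < +oo)%E].

Definition Lp_dist (p : R) (f g : Lp_lt1 p) : R :=
  \int[mu]_x (`|val f x - val g x : R| `^ p).

End Lp_metrics.

Arguments Lnorm_dist {d T R} mu {p} p1.
Arguments Lp_dist {d T R} mu p.

(* Main.v *)
Require Import Defs.
From HB Require Import structures.
From mathcomp Require Import all_boot all_order all_algebra.
From mathcomp Require Import all_classical all_reals all_analysis.
From mathcomp Require Import measurable_realfun.
From mathcomp Require Import ring lra zify.
Set Implicit Arguments.
Unset Strict Implicit.
Unset Printing Implicit Defensive.
Import Order.TTheory GRing.Theory Num.Theory.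
Import numFieldNormedType.Exports.
Local Open Scope classical_set_scope.
Local Open Scope ring_scope.

(** Write q = p s, so that 0 < q < p. The metric of L_p, raised to the power s,
    embeds because of two facts.

    1. There is a process (Th_f), indexed by the functions f in L_p and defined
    on a probability space, whose increments Th_f - Th_g are symmetric p-stable
    variables of scale proportional to ||f - g||_p. As q < p, their absolute
    moment of order q is finite, and by scaling it is a constant multiple of
    ||f - g||_p^q. This is [stable_moments]; it needs p < 2.

    2. The line with the distance |a - b|^q embeds into L_p of the plane. Send a
    to the function T(l (y - a)) |l|^(-q/p) of (l, y), where T is a tent
    function: the p-th power of the L_p distance between the images of a and b
    is invariant under translations and homogeneous of degree q in (a, b), hence
    a constant multiple of |a - b|^q. This is [tent_kernel].

    Apply the second map to the values Th_f and integrate over the probability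
    space: the p-th power of the L_p distance between the images of f and g is a
    multiple of the q-th moment of Th_f - Th_g, that is of ||f - g||_p^(p s).
    Subtracting the image of the zero function makes each image a member of L_p.
    So the three parts of the statement are the same fact, for norms when p >= 1
    and for the metrics d_p when p < 1 ([snowflake_map]).

    All of this takes place on [0, 1] itself. The binary digits of even rank and
    those of odd rank of a uniform point are two independent uniform variables
    ([integral_digits]), so one point of [0, 1] supplies as many independent
    variables as required, and a change of density carries [0, 1] to the line
    ([line_from_unit]) and to the product of [0, 1] with a plane
    ([space_from_unit]).

    The process is built from jumps, which makes it linear in f. The line minus
    0 carries the points of a Poisson process, a point y having an independent
    uniform mark t, and Th_f is the sum of sgn(y) |y|^(-1/p) f(t) over all
    points. The sum over the points with k <= |y| < k + 1 is a compound Poisson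
    sum ([mean_trig_compound]); shells for different k are independent. So the
    characteristic functions of the partial sums over k multiply, their
    exponents add up to a multiple of |l|^p times the integral of |f|^p
    ([series_exponent]), and the partial sums are Cauchy for the moment of order
    p/2 ([levy_sum_cauchy]), hence converge ([Lr_complete]). Moments are read off
    the characteristic function ([abs_moment]), which is how both the Cauchy
    property and the final formula are obtained. *)

(** * Affine changes of variable *)

(** The image measure, packaged with the measurability proof that makes it a
    measure, so that it can be passed around as a single term. *)
Definition image_measure d1 d2 (T1 : measurableType d1) (T2 : measurableType d2)
  (R : realType) (m : {measure set T1 -> \bar R}) (f : T1 -> T2)
  (mf : measurable_fun [set: T1] f) : {measure set T2 -> \bar R} :=
  measure_function_pushforward__canonical__measure_function_Measure m mf.

Lemma integral_image d1 d2 (T1 : measurableType d1) (T2 : measurableType d2)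
  (R : realType) (m : {measure set T1 -> \bar R}) (f : T1 -> T2)
  (mf : measurable_fun [set: T1] f) (F : T2 -> \bar R) :
  measurable_fun setT F -> (forall y, 0 <= F y)%E ->
  (\int[image_measure m mf]_y F y = \int[m]_x F (f x))%E.
Proof.
by move=> mF F0; rewrite (ge0_integral_pushforward mf).
Qed.

Section affine.
Context {R : realType}.
Local Notation leb := (@lebesgue_measure R).
Local Notation TR := (measurableTypeR R).

Lemma measurable_affine (a b : R) : measurable_fun setT (fun x : TR => (a * x + b : TR)).
Proof.
apply: measurable_funD => //; exact: mulrl_measurable.
Qed.

(** Lebesgue measure is the only measure giving half-open intervals their
    length, and the image measure, rescaled, does so. *)
Lemma lebesgue_affine_pos (a b : R) (A : set TR) : 0 < a -> measurable A ->
  (leb A = a%:E * leb ((fun x : R => (a * x + b)%R) @^-1` A))%E.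
Proof.
move=> a0 mA.
pose f (x : TR) : TR := a * x + b.
have mf : measurable_fun setT f by exact: measurable_affine.
pose k : {nonneg R} := NngNum (ltW a0).
transitivity (mscale k (image_measure leb mf) A); last by [].
apply: lebesgue_measure_unique => //= _ [[u v]] _ <-.
rewrite /mscale/= /pushforward.
have -> : f @^-1` `]u, v]%classic = `]((u - b) / a), ((v - b) / a)]%classic.
  apply/seteqP; split => x /=; rewrite !in_itv/= /f ltr_pdivrMr// ler_pdivlMr//.
  - by move=> /andP[h1 h2]; apply/andP; split; lra.
  - by move=> /andP[h1 h2]; apply/andP; split; lra.
rewrite !lebesgue_measure_itv/= !lte_fin ltr_pM2r ?invr_gt0// ltrD2r.
case: ifPn => _; last by rewrite mule0.
rewrite -!EFinD -EFinM; congr EFin; field; lra.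
Qed.

Lemma integral_affine_pos (a b : R) (F : TR -> \bar R) : 0 < a ->
  measurable_fun setT F -> (forall x, 0 <= F x)%E ->
  (\int[leb]_x F x = a%:E * \int[leb]_x F (a * x + b)%R)%E.
Proof.
move=> a0 mF F0.
pose f (x : TR) : TR := a * x + b.
have mf : measurable_fun setT f by exact: measurable_affine.
pose k : {nonneg R} := NngNum (ltW a0).
transitivity (\int[mscale k (image_measure leb mf)]_x F x)%E.
  by apply: eq_measure_integral => A mA _; exact: lebesgue_affine_pos.
rewrite ge0_integral_mscale//.
by congr (_ * _)%E; rewrite integral_image.
Qed.

Lemma ge0_integral_opp (F : TR -> \bar R) :
  measurable_fun setT F -> (forall x, 0 <= F x)%E ->
  (\int[leb]_x F x = \int[leb]_x F (- x)%R)%E.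
Proof.
move=> mF F0.
have mf : measurable_fun setT (fun x : TR => (- x)%R : TR) by exact: oppr_measurable.
transitivity (\int[image_measure leb mf]_x F x)%E.
  by apply: eq_measure_integral => A mA _; rewrite -[LHS]lebesgue_measureN.
by rewrite integral_image.
Qed.

Lemma integral_affine (a b : R) (F : TR -> \bar R) : a != 0 ->
  measurable_fun setT F -> (forall x, 0 <= F x)%E ->
  (\int[leb]_x F (a * x + b)%R = `|a|^-1%:E * \int[leb]_x F x)%E.
Proof.
move=> a0 mF F0.
have [apos|aneg|/eqP] := ltgtP a 0; last by rewrite (negbTE a0).
  rewrite (@integral_affine_pos (- a) b F)//; last by rewrite oppr_gt0.
  rewrite ltr0_norm// muleA -EFinM mulVf ?oppr_eq0// mul1e.
  rewrite ge0_integral_opp//.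
  - by under eq_integral do rewrite mulrN -mulNr.
  - apply: measurableT_comp => //; exact: measurable_affine.
by rewrite (@integral_affine_pos a b F)// gtr0_norm// muleA -EFinM mulVf// mul1e.
Qed.

End affine.

(** * Powers and homogeneous weights *)

Section powers.
Context {R : realType}.
Local Notation leb := (@lebesgue_measure R).
Local Notation TR := (measurableTypeR R).

Lemma measurable_powabs (a : R) : measurable_fun setT (fun x : TR => `|x| `^ a).
Proof. exact: (measurableT_comp (measurable_powR a)). Qed.

(** The weight |x|^-(1 + q) is homogeneous, so replacing a x by x only brings out
    the factor |a|^q. *)
Lemma integral_homogeneous (q a : R) (F : TR -> \bar R) : a != 0 ->
  measurable_fun setT F -> (forall x, 0 <= F x)%E ->
  (\int[leb]_x (F (a * x)%R * (`|x| `^ (- (1 + q)))%:E)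
   = (`|a| `^ q)%:E * \int[leb]_x (F x * (`|x| `^ (- (1 + q)))%:E))%E.
Proof.
move=> a0 mF F0.
pose G x := (F x * (`|x / a| `^ (- (1 + q)))%:E)%E.
have mG : measurable_fun setT G.
  apply: emeasurable_funM => //; apply/measurable_EFinP.
  apply: (measurableT_comp (measurable_powabs _)) => //=.
  exact: mulrr_measurable.
have G0 x : (0 <= G x)%E by rewrite mule_ge0// lee_fin powR_ge0.
transitivity (\int[leb]_x G (a * x + 0)%R)%E.
  by apply: eq_integral => x _; rewrite /G addr0 mulrAC divff// mul1r.
rewrite (integral_affine 0 a0 mG G0).
have na : 0 < `|a| by rewrite normr_gt0.
transitivity (\int[leb]_x ((`|a| `^ (1 + q))%:E * (F x * (`|x| `^ (- (1 + q)))%:E)) *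
  `|a|^-1%:E)%E.
  rewrite muleC; congr (_ * _)%E; apply: eq_integral => x _; rewrite /G.
  rewrite normrM normfV powRM// ?invr_ge0//.
  rewrite -(powR_inv1 (normr_ge0 a)) -powRrM mulN1r opprK.
  by rewrite [in LHS]mulrC EFinM muleCA.
rewrite ge0_integralZl//; last 2 first.
- apply: emeasurable_funM => //; apply/measurable_EFinP; exact: measurable_powabs.
- by move=> x _; rewrite mule_ge0// lee_fin powR_ge0.
rewrite muleAC -EFinM; congr (_%:E * _)%E.
by rewrite powRD ?(gt_eqF na) ?implybT// powRr1// mulrAC divff ?mul1r// gt_eqF.
Qed.

(** At a = 0 both sides vanish, the left one because F does at 0 and the right
    one because 0 `^ q = 0 for q <> 0. *)
Lemma integral_homogeneous0 (q a : R) (F : TR -> \bar R) : q != 0 -> F 0 = 0%E ->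
  measurable_fun setT F -> (forall x, 0 <= F x)%E ->
  (\int[leb]_x (F (a * x)%R * (`|x| `^ (- (1 + q)))%:E)
   = (`|a| `^ q)%:E * \int[leb]_x (F x * (`|x| `^ (- (1 + q)))%:E))%E.
Proof.
move=> q0 F00 mF F0.
have [->|a0] := eqVneq a 0; last exact: integral_homogeneous.
rewrite normr0 powR0// mul0e.
by under eq_integral do rewrite mul0r F00 mul0e; rewrite integral0.
Qed.

Lemma integral_powR_itv (b u v : R) : b != 0 -> 0 < u -> u < v ->
  (\int[leb]_(x in `[u, v]) (x `^ (b - 1))%:E = ((v `^ b - u `^ b) / b)%:E)%E.
Proof.
move=> b0 u0 uv.
pose F (x : R) := x `^ b / b.
have dF (x : R) : 0 < x -> is_derive x 1 F (x `^ (b - 1)).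
  move=> x0; have H := is_derive1_powR b x0.
  rewrite /F; apply: is_derive_eq.
  by rewrite scaler0 add0r /GRing.scale/= mulrA mulVf// mul1r.
have cF (x : R) : 0 < x -> {for x, continuous F}.
  by move=> x0; apply/differentiable_continuous/derivable1_diffP; case: (dF x x0).
have cf (x : R) : 0 < x -> {for x, continuous (fun x : R => x `^ (b - 1))}.
  move=> x0; apply/differentiable_continuous/derivable1_diffP.
  by case: (is_derive1_powR (b - 1) x0).
rewrite (@continuous_FTC2 _ _ F)//.
- by rewrite -EFinB -mulrBl.
- apply: continuous_in_subspaceT => x; rewrite inE/= in_itv/= => /andP[ux _].
  apply: cf; exact: lt_le_trans ux.
- split.
  + move=> x; rewrite in_itv/= => /andP[ux _].
    by have [] := dF x (lt_trans u0 ux).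
  + exact/cvg_at_right_filter/cF.
  + exact/cvg_at_left_filter/cF/(lt_trans u0).
- move=> x; rewrite in_itv/= => /andP[ux _].
  rewrite derive1E; have := dF x (lt_trans u0 ux) => H.
  by rewrite derive_val.
Qed.

(** The integrand is |x|^(r - q - 1) near 0 and |x|^(- q - 1) near infinity. The
    integrals over [1/n, n] are bounded by the two explicit primitives, whatever
    n is; monotone convergence and symmetry do the rest. *)
Lemma integral_min_powR_lty (q r : R) : 0 < q -> q < r ->
  (\int[leb]_x (Num.min 1 (`|x| `^ r) * `|x| `^ (- (1 + q)))%:E < +oo)%E.
Proof.
move=> q0 qr.
pose psi (x : R) := Num.min 1 (`|x| `^ r) * `|x| `^ (- (1 + q)).
have psi0 x : 0 <= psi x by rewrite mulr_ge0 ?powR_ge0// le_min ler01 powR_ge0.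
have mpsi : measurable_fun setT (EFin \o psi).
  apply/measurable_EFinP; apply: measurable_funM; last exact: measurable_powabs.
  by apply: measurable_minr => //; exact: measurable_powabs.
pose I n : set TR := `[(n.+2%:R : R)^-1, n.+2%:R]%classic.
have Ilt n : (n.+2%:R : R)^-1 < 1 by rewrite invf_lt1 ?ltr0n// ltr1n.
have Igt n : 1 < (n.+2%:R : R) by rewrite ltr1n.
have In n : (\int[leb]_(x in I n) (psi x)%:E <= ((r - q)^-1 + q^-1)%:E)%E.
  have IE : I n = `[(n.+2%:R : R)^-1, 1] `|` `]1, n.+2%:R].
    apply/seteqP; split => x /=; rewrite /I/= !in_itv/=.
      by move=> /andP[-> ->]; rewrite andbT/=; case: (leP x 1) => _; [left|right].
    move=> [/andP[-> x1]|/andP[x1 ->]]/=.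
      by rewrite (le_trans x1)// ltW.
    by rewrite andbT (le_trans (ltW (Ilt n)))// ltW.
  rewrite IE ge0_integral_setU//=; last 3 first.
  - exact: measurable_funTS.
  - by move=> x _; rewrite lee_fin.
  - apply/disj_set2P; apply/seteqP; split => // x /= [].
    by rewrite !in_itv/= => /andP[_ x1] /andP[]; rewrite ltNge x1.
  rewrite EFinD leeD//.
  - apply: (@le_trans _ _ (\int[leb]_(x in `[((n.+2%:R : R)^-1)%R,
    1%R]) (x `^ ((r - q) - 1))%:E)%E).
      apply: ge0_le_integral => //=.
      + by move=> x _; rewrite lee_fin.
      + exact: measurable_funTS.
      + by apply/measurable_EFinP; apply: measurable_funTS; exact: measurable_powR.
      + move=> x; rewrite in_itv/= => /andP[x0 x1].
        have xp : 0 < x by rewrite (lt_le_trans _ x0)// invr_gt0 ltr0n.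
        rewrite lee_fin /psi gtr0_norm//.
        apply: (@le_trans _ _ (x `^ r * x `^ (- (1 + q)))).
          by rewrite ler_wpM2r ?powR_ge0// ge_min lexx orbT.
        rewrite -powRD; last by rewrite (gt_eqF xp) implybT.
        by rewrite opprD [-1 - q]addrC addrA lexx.
    rewrite integral_powR_itv ?gt_eqF ?subr_gt0 ?invr_gt0 ?ltr0n// lee_fin powR1.
    by rewrite -[leRHS]mul1r ler_wpM2r ?invr_ge0 ?subr_ge0 ?(ltW qr)// ?gerBl ?powR_ge0.
  - rewrite integral_itv_obnd_cbnd; last exact: measurable_funTS.
    apply: (@le_trans _ _ (\int[leb]_(x in `[1%R, n.+2%:R]) (x `^ ((- q) - 1))%:E)%E).
      apply: ge0_le_integral => //=.
      + by move=> x _; rewrite lee_fin.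
      + exact: measurable_funTS.
      + by apply/measurable_EFinP; apply: measurable_funTS; exact: measurable_powR.
      + move=> x; rewrite in_itv/= => /andP[x0 x1].
        have xp : 0 < x by rewrite (lt_le_trans _ x0).
        rewrite lee_fin /psi gtr0_norm// opprD [- 1 - q]addrC.
        by rewrite ler_piMl ?powR_ge0// ge_min lexx.
    rewrite integral_powR_itv// ?oppr_eq0 ?gt_eqF// lee_fin powR1.
    by rewrite invrN mulrN -mulNr opprB -[leRHS]mul1r ler_wpM2r ?invr_ge0 ?gerBl ?powR_ge0 ?ltW.
have ndI : nondecreasing_seq I.
  move=> m n mn; apply/subsetPset => x /=; rewrite /I/= !in_itv/= => /andP[h1 h2].
  apply/andP; split.
    by rewrite (le_trans _ h1)// lef_pV2 ?posrE ?ltr0n// ler_nat !ltnS.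
  by rewrite (le_trans h2)// ler_nat !ltnS.
have UI : \bigcup_n I n = `]0, +oo[%classic.
  apply/seteqP; split => x /=; rewrite ?in_itv/=.
    move=> [n _]; rewrite /I/= in_itv/= => /andP[h _].
    by rewrite andbT (lt_le_trans _ h)// invr_gt0 ltr0n.
  rewrite andbT => x0.
  have [n1 Hn1] : exists n : nat, x <= n%:R.
    by exists (Num.bound x); rewrite ltW// archi_boundP// ltW.
  have [n2 Hn2] : exists n : nat, x^-1 <= n%:R.
    by exists (Num.bound x^-1); rewrite ltW// archi_boundP// invr_ge0 ltW.
  exists (n1 + n2)%N => //; rewrite /I/= in_itv/=; apply/andP; split.
    rewrite -(invrK x) lef_pV2 ?posrE ?ltr0n ?invr_gt0//.
    by rewrite (le_trans Hn2)// ler_nat; lia.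
  by rewrite (le_trans Hn1)// ler_nat; lia.
have half : (\int[leb]_(x in `]0%R, +oo[) (psi x)%:E <= ((r - q)^-1 + q^-1)%:E)%E.
  rewrite -UI.
  have H : (\int[leb]_(x in I n) (psi x)%:E @[n --> \oo] -->
            \int[leb]_(x in \bigcup_n I n) (psi x)%:E)%E.
    apply: ge0_nondecreasing_set_cvg_integral => //.
    - by move=> n; exact: measurable_itv.
    - by move=> n; exact: measurable_funTS.
    - by move=> n x _; rewrite lee_fin.
  rewrite -(cvg_lim _ H)//; apply: lime_le; first by apply/cvg_ex; eexists; exact: H.
  by near=> n; exact: In.
pose phi (x : R) := (psi x * \1_(`]0, +oo[%classic : set TR) x)%:E.
have mphi : measurable_fun setT phi.
  apply/measurable_EFinP; apply: measurable_funM; first exact/measurable_EFinP.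
  by apply: measurable_indic; exact: measurable_itv.
have phiE' x : phi x = (psi x * (0 < x)%R%:R)%:E.
  by rewrite /phi indicE mem_setE in_itv/= andbT.
have phi0 x : (0 <= phi x)%E by rewrite phiE' lee_fin mulr_ge0.
have phiE : (\int[leb]_x phi x = \int[leb]_(x in `]0%R, +oo[) (psi x)%:E)%E.
  rewrite [RHS]integral_mkcond; apply: eq_integral => x _; rewrite phiE' patchE.
  by rewrite mem_setE in_itv/= andbT; case: ltP; rewrite ?mulr1 ?mulr0.
rewrite (_ : (\int[leb]_x _ = \int[leb]_x (phi x + phi (- x)%R))%E); last first.
  apply: eq_integral => x _; rewrite !phiE' -EFinD; congr EFin; rewrite -/(psi x).
  have -> : psi (- x) = psi x by rewrite /psi normrN.
  rewrite oppr_gt0; case: (ltgtP x 0) => x0; rewrite ?mulr0 ?mulr1 ?addr0 ?add0r//.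
  by rewrite /psi x0 normr0 [_ `^ - _]powR0 ?mulr0// oppr_eq0 gt_eqF// addr_gt0.
rewrite ge0_integralD//; last first.
  by apply: (measurableT_comp mphi); exact: oppr_measurable.
rewrite -ge0_integral_opp// phiE; apply: (@le_lt_trans _ _ (((r - q)^-1 + q^-1)%:E + ((r
  - q)^-1 + q^-1)%:E)%E); first exact: leeD.
by rewrite -EFinD ltry.
Unshelve. all: by end_near. Qed.
End powers.

(** * Binary digits of a uniform variable *)

Section unit_interval.
Context {R : realType}.
Local Notation leb := (@lebesgue_measure R).
Local Notation TR := (measurableTypeR R).
Local Notation mu := (lebesgue01 R).

(** Discarding the endpoint 1 costs nothing, and [0, 1[ is the disjoint union of
    its halves [0, 1/2[ and [1/2, 1[, on which the first binary digit is constant. *)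
Lemma lebesgue01E (A : set TR) : measurable A -> mu A = leb (A `&` `[0, 1[).
Proof.
move=> mA; apply/eqP; rewrite eq_le; apply/andP; split; last first.
  rewrite /lebesgue01 /mrestr le_measure ?inE//; try exact: measurableI.
  by apply: setIS => x /=; rewrite !in_itv/= => /andP[-> /ltW ->].
rewrite /lebesgue01 /mrestr.
apply: (@le_trans _ _ (leb ((A `&` `[0%R, 1%R[) `|` [set 1%R]))).
  rewrite le_measure ?inE//; try exact: measurableI.
    by apply: measurableU; [exact: measurableI|exact: measurable_set1].
  move=> x [Ax]/=; rewrite in_itv/= => /andP[x0]; rewrite le_eqVlt => /orP[/eqP ->|x1].
    by right.
  by left; split => //; rewrite /= in_itv/= x0.
apply: (le_trans (measureU2 _ _ _)) => //; first exact: measurableI.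
rewrite [X in (_ + X)%E](_ : _ = 0%E) ?adde0//; exact: lebesgue_measure_set1.
Qed.

Lemma lebesgue01_setT : mu setT = 1%E.
Proof.
rewrite lebesgue01E// setTI lebesgue_measure_itv/= lte_fin ltr01.
by rewrite -EFinB subr0.
Qed.

HB.instance Definition _ :=
  Measure_isProbability.Build _ _ _ (lebesgue01 R) lebesgue01_setT.

Lemma lebesgue01_halves (A : set TR) : measurable A ->
  (mu A = (2^-1)%:E * mu ((fun x : R => (x / 2)%R) @^-1` A)
        + (2^-1)%:E * mu ((fun x : R => ((x + 1) / 2)%R) @^-1` A))%E.
Proof.
move=> mA.
have mh0 : measurable_fun setT (fun x : TR => x / 2 : TR) by exact: mulrr_measurable.
have mh1 : measurable_fun setT (fun x : TR => (x + 1) / 2 : TR).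
  apply: (measurableT_comp (mulrr_measurable _)) => //=.
  exact: measurable_funD.
have mA0 : measurable ((fun x : TR => x / 2 : TR) @^-1` A).
  by rewrite -[X in measurable X]setTI; exact: mh0.
have mA1 : measurable ((fun x : TR => (x + 1) / 2 : TR) @^-1` A).
  by rewrite -[X in measurable X]setTI; exact: mh1.
rewrite !lebesgue01E//.
have -> : A `&` `[0, 1[ = (A `&` `[0, 2^-1[) `|` (A `&` `[2^-1, 1[).
  rewrite -setIUr; congr (_ `&` _); apply/seteqP; split => x /=; rewrite !in_itv/=.
    move=> /andP[x0 x1]; case: (ltP x 2^-1) => h; first by left; rewrite x0.
    by right; rewrite x1.
  by move=> [|] /andP[h1 h2]; apply/andP; split; lra.
rewrite measureU//; last 3 first.
- exact: measurableI.
- exact: measurableI.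
- apply/seteqP; split => // x /= [[_ +] [_]]; rewrite !in_itv/= => /andP[_ h] /andP[].
  by rewrite leNgt h.
have h2 : 0 < 2^-1 :> R by rewrite invr_gt0.
congr (_ + _)%E.
- apply: (eq_trans (@lebesgue_affine_pos _ 2^-1 0 _ h2 (measurableI _ _ mA (measurable_itv _)))).
  congr (_ * leb _)%E; apply/seteqP; split => x /=; rewrite !in_itv/= addr0 mulrC.
    by move=> [? /andP[? ?]]; split=> //; apply/andP; split; lra.
  by move=> [? /andP[? ?]]; split=> //; apply/andP; split; lra.
- apply: (eq_trans (@lebesgue_affine_pos _ 2^-1 2^-1 _ h2 (measurableI _ _ mA
  (measurable_itv _)))).
  congr (_ * leb _)%E; apply/seteqP; split => x /=; rewrite !in_itv/=.
    rewrite (_ : 2^-1 * x + 2^-1 = (x + 1) / 2); last by lra.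
    by move=> [? /andP[? ?]]; split=> //; apply/andP; split; lra.
  rewrite (_ : 2^-1 * x + 2^-1 = (x + 1) / 2); last by lra.
  by move=> [? /andP[? ?]]; split=> //; apply/andP; split; lra.
Qed.

Definition digit (x : R) : bool := 2^-1 <= x.
Definition doubling (x : R) : R := 2 * x - (digit x)%:R.

Lemma doublingE (x : R) : doubling x = if 2^-1 <= x then 2 * x + (-1) else 2 * x.
Proof. by rewrite /doubling /digit; case: ifP; rewrite ?subr0. Qed.

Lemma measurable_digit : measurable_fun setT (digit : TR -> bool).
Proof. exact: measurable_fun_ler. Qed.

Lemma measurable_doubling : measurable_fun setT (doubling : TR -> TR).
Proof.
rewrite (_ : doubling = fun x => if 2^-1 <= x then 2 * x + (-1) else 2 * x); last first.
  by apply/funext => x; exact: doublingE.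
apply: measurable_fun_ifT => //; first exact: measurable_digit.
exact: measurable_affine.
Qed.

(** The first binary digit is a fair coin, independent of the remaining digits,
    which form again a uniform variable. *)
Lemma lebesgue01_doubling (B : bool -> set TR) : (forall b, measurable (B b)) ->
  (mu [set x | B (digit x) (doubling x)]
    = (2^-1)%:E * mu (B false) + (2^-1)%:E * mu (B true))%E.
Proof.
move=> mB.
have mA : measurable [set x : TR | B (digit x) (doubling x)].
  have -> : [set x : TR | B (digit x) (doubling x)] =
    ((digit @^-1` [set true]) `&` (doubling @^-1` B true)) `|`
    ((digit @^-1` [set false]) `&` (doubling @^-1` B false)).
    apply/seteqP; split => x /=; first by case: (digit x) => h; [left|right].
    by move=> [[->]|[->]].
  have md := measurable_digit; have mD := measurable_doubling.
  apply: measurableU; apply: measurableI.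
  - by rewrite -[X in measurable X]setTI; exact: md.
  - by rewrite -[X in measurable X]setTI; exact: mD.
  - by rewrite -[X in measurable X]setTI; exact: md.
  - by rewrite -[X in measurable X]setTI; exact: mD.
have mh0 : measurable_fun setT (fun x : TR => x / 2 : TR) by exact: mulrr_measurable.
have mh1 : measurable_fun setT (fun x : TR => (x + 1) / 2 : TR).
  apply: (measurableT_comp (mulrr_measurable _)) => //=.
  exact: measurable_funD.
rewrite lebesgue01_halves//; congr (_ * _ + _ * _)%E.
- rewrite !lebesgue01E//; last by rewrite -[X in measurable X]setTI; exact: mh0.
  congr (leb _); apply/seteqP; split => x /=; rewrite in_itv/= /doubling /digit.
    move=> [+ /andP[x0 x1]]; rewrite (_ : (2^-1 <= x / 2) = false); last by apply/negbTE;
      rewrite -ltNge; lra.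
    by rewrite subr0 mulrC divfK// x0.
  move=> [+ /andP[x0 x1]]; rewrite (_ : (2^-1 <= x / 2) = false); last by apply/negbTE;
    rewrite -ltNge; lra.
  by rewrite subr0 [2 * _]mulrC divfK// x0.
- rewrite !lebesgue01E//; last by rewrite -[X in measurable X]setTI; exact: mh1.
  congr (leb _); apply/seteqP; split => x /=; rewrite in_itv/= /doubling /digit.
    move=> [+ /andP[x0 x1]]; rewrite (_ : (2^-1 <= (x + 1) / 2) = true); last by lra.
    by rewrite [2 * _]mulrC divfK// addrK x0.
  move=> [+ /andP[x0 x1]]; rewrite (_ : (2^-1 <= (x + 1) / 2) = true); last by lra.
  by rewrite [2 * _]mulrC divfK// addrK x0.
Qed.

(** Uniqueness for the recursion satisfied by the difference F a b between the
    joint tail probability P(even_digits > a, odd_digits > b) and the product of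
    the tail probabilities. For each a, one of the points 2 a and 2 a - 1 lies
    outside [0, 1[, where F vanishes or reduces to its marginal F _ (-1). Hence a bound
    on that marginal, and then a bound on F, is halved by each use of the
    recursion. *)
Lemma swap_contraction (F : R -> R -> R) :
  (forall a b, F a b = 2^-1 * F b (2 * a) + 2^-1 * F b (2 * a - 1)) ->
  (forall a b, 1 <= b -> F a b = 0) ->
  (forall a b, b < 0 -> F a b = F a (-1)) ->
  (forall a, 1 <= a -> F a (-1) = 0) -> (forall a, a < 0 -> F a (-1) = 0) ->
  (forall a b, `|F a b| <= 1) ->
  forall a b, F a b = 0.
Proof.
move=> Frec F1 Fneg Fm1 Fm0 Fb.
have small (x : R) : (forall n, `|x| <= 2^-1 ^+ n) -> x = 0.
  move=> xn; apply/eqP; rewrite -normr_eq0 eq_le normr_ge0 andbT.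
  have /cvg_lim <- // : (fun n => 2^-1 ^+ n : R) @ \oo --> (0 : R).
    by apply: cvg_expr; rewrite ger0_norm ?invr_ge0// invf_lt1// ltr1n.
  apply: limr_ge; last by near=> n; exact: xn.
  apply/cvg_ex; exists (0 : R).
  by apply: cvg_expr; rewrite ger0_norm ?invr_ge0// invf_lt1// ltr1n.
pose e b := F b (-1).
have erec b : e b = 2^-1 * e (2 * b) + 2^-1 * e (2 * b - 1).
  have h c : F (-1) c = e c by rewrite Frec !(@Fneg c) /e; lra.
  by rewrite {1}/e Frec !h.
have e0 b : e b = 0.
  apply: small => n; elim: n b => [|n IH] b; first by rewrite expr0 Fb.
  rewrite erec exprS; case: (ltP b 2^-1) => hb.
    rewrite (_ : e (2 * b - 1) = 0); last by apply: Fm0; lra.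
    by rewrite mulr0 addr0 normrM ger0_norm ?invr_ge0// ler_wpM2l ?invr_ge0.
  rewrite (_ : e (2 * b) = 0); last by apply: Fm1; lra.
  by rewrite mulr0 add0r normrM ger0_norm ?invr_ge0// ler_wpM2l ?invr_ge0.
move=> a b; apply: small => n; elim: n a b => [|n IH] a b; first by rewrite expr0 Fb.
rewrite Frec exprS; case: (ltP a 2^-1) => ha.
  rewrite (Fneg b (2 * a - 1)); last by lra.
  rewrite -/(e b) e0 mulr0 addr0 normrM ger0_norm ?invr_ge0// ler_wpM2l ?invr_ge0//.
rewrite (F1 b (2 * a)); last by lra.
by rewrite mulr0 add0r normrM ger0_norm ?invr_ge0// ler_wpM2l ?invr_ge0.
Unshelve. all: by end_near. Qed.

(** The number whose binary digits are the first n digits of x of ranks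
    0, 2, 4 and so on. *)
Fixpoint even_digits_approx (n : nat) (x : R) : R :=
  if n is m.+1 then ((digit x)%:R + even_digits_approx m (doubling (doubling x))) / 2
  else 0.

Definition even_digits (x : R) : R := limn (even_digits_approx ^~ x).
Definition odd_digits (x : R) : R := even_digits (doubling x).

Lemma even_digits_approx_itv n x : 0 <= even_digits_approx n x <= 1.
Proof.
elim: n x => [|n IH] x /=; first by rewrite lexx ler01.
have /andP[h1 h2] := IH (doubling (doubling x)).
by case: (digit x); rewrite ?mulr1n ?mulr0n; apply/andP; split; lra.
Qed.

Lemma even_digits_cvg x : (even_digits_approx n x) @[n --> \oo] --> even_digits x.
Proof.
apply: nondecreasing_is_cvgn.
- apply/nondecreasing_seqP => n; elim: n x => [|n IH] x.
    by have /andP[] := even_digits_approx_itv 1 x.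
  by rewrite /= ler_pM2r ?invr_gt0// lerD2l; exact: IH.
- by exists 1 => _ [n _ <-]; have /andP[] := even_digits_approx_itv n x.
Qed.

(** Removing the first digit exchanges digits of even and odd rank. *)
Lemma even_digitsE x : even_digits x = ((digit x)%:R + odd_digits (doubling x)) / 2.
Proof.
rewrite {1}/even_digits; apply: cvg_lim => //; rewrite -cvg_shiftS/=.
apply: cvgM; last exact: cvg_cst.
by apply: cvgD; [exact: cvg_cst | exact: even_digits_cvg].
Qed.

Lemma even_digits_itv x : 0 <= even_digits x <= 1.
Proof.
apply/andP; split.
- apply: limr_ge; first exact: even_digits_cvg.
  by near=> n; have /andP[] := even_digits_approx_itv n x.
- apply: limr_le; first exact: even_digits_cvg.
  by near=> n; have /andP[] := even_digits_approx_itv n x.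
Unshelve. all: by end_near. Qed.

Lemma measurable_even_digits : measurable_fun setT (even_digits : TR -> TR).
Proof.
apply: (@measurable_fun_cvg _ _ _ _ even_digits_approx); last first.
  by move=> x _; exact: even_digits_cvg.
elim=> [|n IH] //=.
apply: (measurableT_comp (mulrr_measurable _)) => //=.
apply: measurable_funD.
  apply: (measurableT_comp (f := fun b : bool => b%:R : R)) => //.
  exact: measurable_digit.
exact: (measurableT_comp (measurableT_comp IH measurable_doubling) measurable_doubling).
Qed.

Lemma measurable_odd_digits : measurable_fun setT (odd_digits : TR -> TR).
Proof. exact: (measurableT_comp measurable_even_digits measurable_doubling). Qed.

End unit_interval.

(** * Independence of the even and the odd digits *)

Section splitting.
Context {R : realType}.
Local Notation TR := (measurableTypeR R).
Local Notation mu := (lebesgue01 R).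

(** Rays generate the Borel sets and are stable under intersection, and the joint
    law of the digits on rays is determined by a recursion. *)
Let ray (a : R) : set TR := `]a, +oo[%classic.

Let measurable_ray a : measurable (ray a). Proof. exact: measurable_itv. Qed.

Definition ray_prob (a : R) : R := Num.min 1 (Num.max 0 (1 - a)).

Lemma lebesgue01_ray (a : R) : mu (ray a) = (ray_prob a)%:E.
Proof.
rewrite lebesgue01E// /ray_prob.
have [a0|a0] := ltP a 0.
  rewrite (_ : _ `&` _ = `[0, 1[%classic :> set TR).
    rewrite lebesgue_measure_itv/= lte_fin ltr01 -EFinB subr0; congr EFin.
    by rewrite max_r ?min_l//; lra.
  apply/seteqP; split => x /=; first by case.
  rewrite !in_itv/= => /andP[x0 x1]; rewrite x0 x1; split => //.
  by rewrite /ray/= in_itv/= andbT; lra.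
have [a1|a1] := ltP a 1.
  rewrite (_ : _ `&` _ = `]a, 1[%classic :> set TR).
    rewrite lebesgue_measure_itv/= lte_fin a1 -EFinB; congr EFin.
    by rewrite max_r ?min_r//; lra.
  apply/seteqP; split => x /=; rewrite /ray/= !in_itv/= ?andbT.
    by move=> [-> /andP[_ ->]].
  by move=> /andP[h ->]; split=> //; rewrite andbT; lra.
rewrite (_ : _ `&` _ = set0).
  by rewrite measure0 max_l ?min_r//; lra.
apply/seteqP; split => x //=; rewrite /ray/= !in_itv/= ?andbT => -[? /andP[]]; lra.
Qed.

Lemma ray_probE (a : R) : ray_prob a = 2^-1 * ray_prob (2 * a) + 2^-1 * ray_prob (2 * a - 1).
Proof.
rewrite /ray_prob.
have [a0|a0] := ltP a 0; first by rewrite !max_r ?min_l//; lra.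
have [a1|a1] := ltP a 2^-1.
  rewrite (_ : Num.min 1 (Num.max 0 (1 - (2 * a - 1))) = 1); last by rewrite max_r ?min_l//; lra.
  by rewrite !max_r ?min_r//; lra.
have [a2|a2] := ltP a 1.
  rewrite (_ : Num.max 0 (1 - 2 * a) = 0); last by rewrite max_l//; lra.
  by rewrite !max_r ?min_r//; lra.
by rewrite !max_l ?min_r//; lra.
Qed.

Let joint (a b : R) := mu ((even_digits : TR -> TR) @^-1` ray a `&` (odd_digits : TR ->
  TR) @^-1` ray b).

Let mpre (f : TR -> TR) (A : set TR) : measurable_fun setT f -> measurable A ->
  measurable (f @^-1` A).
Proof. by move=> mf mA; rewrite -[X in measurable X]setTI; exact: mf. Qed.

Let mev := @measurable_even_digits R.
Let modd := @measurable_odd_digits R.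

Let joint_fin a b : joint a b \is a fin_num.
Proof.
rewrite /joint fin_num_measure//.
by apply: measurableI; apply: mpre.
Qed.

Let joint_le1 a b : 0 <= fine (joint a b) <= 1.
Proof.
rewrite fine_ge0//= -lee_fin fineK//.
by apply: probability_le1; apply: measurableI; apply: mpre.
Qed.

(** One step of the digit expansion [even_digitsE], with the first digit
    integrated out. *)
Let jointE a b : fine (joint a b) =
  2^-1 * fine (joint b (2 * a)) + 2^-1 * fine (joint b (2 * a - 1)).
Proof.
apply: EFin_inj; rewrite EFinD !EFinM !fineK//.
pose B (d : bool) : set TR :=
  [set y | even_digits y \in ray b /\ ((d%:R + odd_digits y) / 2) \in ray a].
have BE d : B d = (even_digits : TR -> TR) @^-1` ray b `&`
    (odd_digits : TR -> TR) @^-1` ray (2 * a - d%:R).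
  apply/seteqP; split => x; rewrite /B/= !inE /ray/= !in_itv/= !andbT => -[h1 h2].
    by split => //; rewrite ltrBlDl mulrC -ltr_pdivlMr.
  by split => //; rewrite ltr_pdivlMr// mulrC -ltrBlDl.
rewrite {1}/joint.
have -> : (even_digits : TR -> TR) @^-1` ray a `&` (odd_digits : TR -> TR) @^-1` ray b =
    [set x | B (digit x) (doubling x)].
  apply/seteqP; split => x; rewrite /B/= !inE -even_digitsE /odd_digits.
    by move=> [].
  by move=> [].
rewrite lebesgue01_doubling.
  by rewrite !BE subr0.
by move=> d; rewrite BE; apply: measurableI; apply: mpre.
Qed.

Let ray_prob_itv a : 0 <= ray_prob a <= 1.
Proof. by rewrite /ray_prob ge_min lexx le_min ler01 le_max lexx. Qed.

Let jointP a b : joint a b = (ray_prob a * ray_prob b)%:E.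
Proof.
rewrite -[LHS]fineK//; congr EFin; apply/eqP; rewrite -subr_eq0; apply/eqP; move: a b.
have p1 (a : R) : 1 <= a -> ray_prob a = 0.
  by move=> a1; rewrite /ray_prob max_l ?min_r//; lra.
have p0 (a : R) : a < 0 -> ray_prob a = 1.
  by move=> a0; rewrite /ray_prob max_r ?min_l//; lra.
have r1 (a : R) f : (forall x, f x <= 1) -> 1 <= a -> (f : TR -> TR) @^-1` ray a = set0.
  move=> f1 a1; apply/seteqP; split => x //=; rewrite /ray/= in_itv/= andbT.
  by rewrite ltNge (le_trans (f1 x)).
have r0 (a : R) f : (forall x, 0 <= f x) -> a < 0 -> (f : TR -> TR) @^-1` ray a = setT.
  move=> f1 a1; apply/seteqP; split => x //= _; rewrite /ray/= in_itv/= andbT.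
  by rewrite (lt_le_trans a1).
have e1 (x : R) : even_digits x <= 1 by have /andP[] := even_digits_itv x.
have e0 (x : R) : 0 <= even_digits x by have /andP[] := even_digits_itv x.
have o1 (x : R) : odd_digits x <= 1 by exact: e1.
have o0 (x : R) : 0 <= odd_digits x by exact: e0.
apply: swap_contraction.
- by move=> a b; rewrite jointE {1}(ray_probE a); ring.
- by move=> a b b1; rewrite /joint (r1 b odd_digits)// setI0 measure0 (p1 b)// mulr0 subrr.
- by move=> a b b0; rewrite /joint (r0 b odd_digits)// (r0 (-1) odd_digits)// (p0 b)// (p0 (-1)).
- by move=> a a1; rewrite /joint (r1 a even_digits)// set0I measure0 (p1 a)// mul0r subrr.
- move=> a a0; rewrite /joint (r0 a even_digits)// (r0 (-1) odd_digits)// setIT.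
  by rewrite lebesgue01_setT (p0 a)// (p0 (-1))// mulr1 subrr.
- move=> a b; have /andP[h1 h2] := joint_le1 a b.
  have /andP[h3 h4] := ray_prob_itv a; have /andP[h5 h6] := ray_prob_itv b.
  have h7 : 0 <= ray_prob a * ray_prob b by rewrite mulr_ge0.
  have h8 : ray_prob a * ray_prob b <= 1 by rewrite mulr_ile1.
  by rewrite ler_norml; apply/andP; split; lra.
Qed.

Let ray_unique (m1 m2 : {measure set TR -> \bar R}) :
  (forall a, m1 (ray a) = m2 (ray a)) -> (forall a, m1 (ray a) < +oo)%E ->
  forall A, measurable A -> m1 A = m2 A.
Proof.
move=> h hoo A mA.
apply: (@measure_unique _ R TR (@RGenOInfty.G R) (fun n => ray (- n%:R))) => //.
- exact: RGenOInfty.measurableE.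
- move=> _ _ [x ->] [y ->]; exists (Num.max x y).
  apply/seteqP; split => z /=; rewrite !in_itv/= !andbT gt_max.
    by move=> [-> ->].
  by move=> /andP[].
- by move=> n; exists (- n%:R).
- apply/seteqP; split => // x _; exists (Num.bound (- x)) => //.
  rewrite /ray/= in_itv/= andbT ltrNl.
  case: (ltP x 0) => x0; first by apply: archi_boundP; rewrite oppr_ge0 ltW.
  apply: (@le_lt_trans _ _ 0); first by rewrite oppr_le0.
  by case: (x == 0) / eqP => [->|/eqP]; rewrite ltr0n /Num.bound.
- by move=> _ [a ->]; exact: h.
Qed.

(** Independence on rays extends to Borel sets in one variable at a time, two
    finite measures that agree on rays being equal. *)
Lemma digits_independent (A B : set TR) : measurable A -> measurable B ->
  (mu ((even_digits : TR -> TR) @^-1` A `&` (odd_digits : TR -> TR) @^-1` B) = mu A * mu B)%E.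
Proof.
move=> mA mB.
have fin a : (mu (ray a) < +oo)%E by rewrite lebesgue01_ray ltry.
(* fix a ray for the even digits *)
have step1 a : (mu ((even_digits : TR -> TR) @^-1` ray a `&` (odd_digits : TR -> TR) @^-1` B)
    = mu (ray a) * mu B)%E.
  have mE : measurable ((even_digits : TR -> TR) @^-1` ray a) by exact: mpre.
  have k0 : 0 <= ray_prob a by have /andP[] := ray_prob_itv a.
  have := @ray_unique (image_measure (mrestr mu mE) modd) (mscale (NngNum k0) mu) _ _ B mB.
  rewrite /= /pushforward /mrestr/= /mscale/= lebesgue01_ray setIC; apply.
  - by move=> b; rewrite lebesgue01_ray setIC -/(joint a b) jointP EFinM.
  - by move=> b; rewrite setIC -/(joint a b) jointP ltry.
have mO : measurable ((odd_digits : TR -> TR) @^-1` B) by exact: mpre.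
have k0 : 0 <= fine (mu B) by apply: fine_ge0.
have := @ray_unique (image_measure (mrestr mu mO) mev) (mscale (NngNum k0) mu) _ _ A mA.
have finB : mu B \is a fin_num by rewrite fin_num_measure.
rewrite /= /pushforward /mrestr/= /mscale/= fineK// => ->.
- by rewrite muleC.
- by move=> a; rewrite step1 muleC.
- by move=> a; rewrite step1 lebesgue01_ray -(fineK finB) -EFinM ltry.
Qed.

Lemma measurable_digits :
  measurable_fun setT (fun x : TR => (even_digits x, odd_digits x) : TR * TR).
Proof. by apply: measurable_fun_pair; [exact: mev|exact: modd]. Qed.

(** A function of two independent uniform variables can be realised as a function
    of one, so independent randomness is always at hand on [0, 1]. *)
Lemma integral_digits (G : TR * TR -> \bar R) :
  measurable_fun setT G -> (forall z, 0 <= G z)%E ->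
  (\int[mu]_x G (even_digits x, odd_digits x) = \int[mu]_a \int[mu]_b G (a, b))%E.
Proof.
move=> mG G0.
rewrite -(integral_image mu measurable_digits)//.
rewrite -[RHS](@fubini_tonelli1 _ _ _ _ _ mu mu)//.
apply: eq_measure_integral => A mA _; apply/esym.
apply: product_measure_unique => //= B C mB mC.
exact: digits_independent.
Qed.

End splitting.

(** * Independent sums and their characteristic functions *)

Section independence.
Context {R : realType}.
Local Notation TR := (measurableTypeR R).
Local Notation mu := (lebesgue01 R).
Implicit Types (u v a : TR -> R).

Definition mean (u : TR -> R) : R := \int[mu]_x u x.

Lemma integral01_cst (c : \bar R) : (\int[mu]_x c = c)%E.
Proof.
by rewrite integral_cst// [X in (_ * X)%E](_ : _ = 1%E) ?mule1//; exact: lebesgue01_setT.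
Qed.

Lemma mean_cst (c : R) : mean (cst c) = c.
Proof. by rewrite /mean /Rintegral /= integral01_cst. Qed.

Lemma integrable_le1 u : measurable_fun setT u -> (forall x, `|u x| <= 1) ->
  mu.-integrable setT (EFin \o u).
Proof.
move=> mu_ u1; apply: measurable_bounded_integrable => //.
- by rewrite [X in (X < _)%E](_ : _ = 1%E) ?ltry//; exact: lebesgue01_setT.
- by exists 1; split => // M M1 x _ /=; rewrite (le_trans (u1 x))// ltW.
Qed.

Lemma integral1D u : measurable_fun setT u -> (forall x, `|u x| <= 1) ->
  (\int[mu]_x (1 + u x)%:E = (1 + mean u)%:E)%E.
Proof.
move=> mu_ u1.
have iu := integrable_le1 mu_ u1.
have i1 : mu.-integrable setT (EFin \o cst (1 : R)).
  by apply: integrable_le1 => // x; rewrite normr1.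
under eq_integral do rewrite EFinD.
rewrite integralD_EFin// EFinD integral01_cst.
by rewrite /mean /Rintegral fineK// integrable_fin_num.
Qed.

(** [integral_digits] handles nonnegative functions; adding 1 brings a function
    bounded by 1 within its reach. *)
Lemma mean_unique u (c : R) : measurable_fun setT u -> (forall x, `|u x| <= 1) ->
  (\int[mu]_x (1 + u x)%:E = (1 + c)%:E)%E -> mean u = c.
Proof. by move=> mu_ u1; rewrite integral1D// => -[/addrI]. Qed.

Lemma mean_le1 u : measurable_fun setT u -> (forall x, `|u x| <= 1) -> `|mean u| <= 1.
Proof.
move=> mu_ u1; have iu := integrable_le1 mu_ u1.
rewrite (le_trans (le_normr_Rintegral _ iu))// -lee_fin /Rintegral fineK; last first.
  by apply: integrable_fin_num => //; exact: (integrable_norm iu).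
apply: (@le_trans _ _ (\int[mu]_x (cst 1%E x))%E); last first.
  by rewrite integral01_cst.
apply: ge0_le_integral => //.
- by apply/measurable_EFinP; exact: measurableT_comp.
- by move=> x _; rewrite lee_fin.
Qed.

Lemma meanB u v : measurable_fun setT u -> (forall x, `|u x| <= 1) ->
  measurable_fun setT v -> (forall x, `|v x| <= 1) ->
  mean (fun x => u x - v x) = mean u - mean v.
Proof. by move=> mu_ u1 mv v1; rewrite /mean RintegralB//; exact: integrable_le1. Qed.

Lemma mean_even u : measurable_fun setT u -> (forall x, `|u x| <= 1) ->
  mean (u \o even_digits) = mean u.
Proof.
move=> mu_ u1.
have m1 : measurable_fun setT (EFin \o (fun x => 1 + u x)).
  by apply/measurable_EFinP; exact: measurable_funD.
have h x : (0 <= (1 + u x)%:E)%E.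
  by rewrite lee_fin -lerBlDl sub0r; have := u1 x; rewrite ler_norml => /andP[].
apply: mean_unique; [exact: (measurableT_comp mu_ measurable_even_digits)|by move=> x;
  exact: u1|].
transitivity (\int[mu]_x (fun z : TR * TR => (1 + u z.1)%:E) (even_digits x,
  odd_digits x))%E => //.
rewrite (@integral_digits _ (fun z : TR * TR => (1 + u z.1)%:E))//.
  under eq_integral do rewrite /= integral01_cst.
  exact: integral1D.
exact: (measurableT_comp m1 measurable_fst).
Qed.

Lemma mean_odd u : measurable_fun setT u -> (forall x, `|u x| <= 1) ->
  mean (u \o odd_digits) = mean u.
Proof.
move=> mu_ u1.
have m1 : measurable_fun setT (EFin \o (fun x => 1 + u x)).
  by apply/measurable_EFinP; exact: measurable_funD.
have h x : (0 <= (1 + u x)%:E)%E.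
  by rewrite lee_fin -lerBlDl sub0r; have := u1 x; rewrite ler_norml => /andP[].
apply: mean_unique; [exact: (measurableT_comp mu_ measurable_odd_digits)|by move=> x; exact: u1|].
transitivity (\int[mu]_x (fun z : TR * TR => (1 + u z.2)%:E) (even_digits x,
  odd_digits x))%E => //.
rewrite (@integral_digits _ (fun z : TR * TR => (1 + u z.2)%:E))//.
  by rewrite /= integral01_cst integral1D.
exact: (measurableT_comp m1 measurable_snd).
Qed.

(** The product rule for (1 + u) (1 + v) comes from [integral_digits], and
    expanding it leaves the product rule for u v. *)
Lemma mean_prod u v : measurable_fun setT u -> (forall x, `|u x| <= 1) ->
  measurable_fun setT v -> (forall x, `|v x| <= 1) ->
  mean (fun x => u (even_digits x) * v (odd_digits x)) = mean u * mean v.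
Proof.
move=> mu_ u1 mv v1.
have nn (w : TR -> R) : (forall x, `|w x| <= 1) -> forall x : TR, 0 <= 1 + w x.
  by move=> w1 x; rewrite -lerBlDl sub0r; have := w1 x; rewrite ler_norml => /andP[].
have mue : measurable_fun setT (u \o even_digits)
  by exact: (measurableT_comp mu_ measurable_even_digits).
have mvo : measurable_fun setT (v \o odd_digits)
  by exact: (measurableT_comp mv measurable_odd_digits).
have muv : measurable_fun setT (fun x : TR => u (even_digits x) * v (odd_digits x))
  by exact: measurable_funM.
have uv1 x : `|u (even_digits x) * v (odd_digits x)| <= 1 by rewrite normrM mulr_ile1.
have E1 : (\int[mu]_x ((1 + u (even_digits x)) * (1 + v (odd_digits x)))%:E
    = ((1 + mean u) * (1 + mean v))%:E)%E.
  transitivity (\int[mu]_x (fun z : TR * TR => ((1 + u z.1) * (1 + v z.2))%:E)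
    (even_digits x, odd_digits x))%E => //.
  rewrite (@integral_digits _ (fun z : TR * TR => ((1 + u z.1) * (1 + v z.2))%:E)); last 2 first.
  - apply/measurable_EFinP; apply: measurable_funM; apply: measurable_funD => //.
      exact: (measurableT_comp mu_ measurable_fst).
    exact: (measurableT_comp mv measurable_snd).
  - by move=> z; rewrite lee_fin mulr_ge0// nn.
  transitivity (\int[mu]_x ((1 + mean v)%:E * (1 + u x)%:E))%E.
    apply: eq_integral => x _; under eq_integral do rewrite EFinM.
    rewrite /= ge0_integralZl//; [by rewrite integral1D// muleC| | |].
    - by apply/measurable_EFinP; exact: measurable_funD.
    - by move=> y _; rewrite lee_fin nn.
    - by rewrite lee_fin nn.
  rewrite ge0_integralZl//; last first.
  - rewrite lee_fin -lerBlDl sub0r.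
    by have := mean_le1 mv v1; rewrite ler_norml => /andP[].
  - by move=> y _; rewrite lee_fin nn.
  - by apply/measurable_EFinP; exact: measurable_funD.
  by rewrite integral1D// -EFinM mulrC.
have E2 : mean (fun x => (1 + u (even_digits x)) * (1 + v (odd_digits x))) = (1 + mean u)
  * (1 + mean v).
  by rewrite /mean /Rintegral E1.
have i1 : mu.-integrable setT (EFin \o cst (1 : R)).
  by apply: integrable_le1 => // x; rewrite normr1.
have iu : mu.-integrable setT (EFin \o (u \o even_digits))
  by apply: integrable_le1 => // x; exact: u1.
have iv : mu.-integrable setT (EFin \o (v \o odd_digits))
  by apply: integrable_le1 => // x; exact: v1.
have iuv : mu.-integrable setT (EFin \o (fun x : TR => u (even_digits x) * v (odd_digits x))).
  exact: integrable_le1.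
have i12 : mu.-integrable setT (EFin \o (fun x : TR => 1 + u (even_digits x))).
  by apply: eq_integrable (integrableD measurableT i1 iu).
have i34 : mu.-integrable setT (EFin \o (fun x : TR => v (odd_digits x) + u (even_digits
  x) * v (odd_digits x))).
  by apply: eq_integrable (integrableD measurableT iv iuv).
have : mean (fun x => (1 + u (even_digits x)) * (1 + v (odd_digits x))) =
    1 + mean u + (mean v + mean (fun x => u (even_digits x) * v (odd_digits x))).
  rewrite -(mean_even mu_ u1) -(mean_odd mv v1) /mean.
  under eq_Rintegral do rewrite mulrDr mulr1 mulrDl mul1r.
  rewrite RintegralD//; congr (_ + _).
    rewrite RintegralD//; congr (_ + _).
    exact: mean_cst.
  by rewrite RintegralD.
rewrite E2; move: (mean _) => w; lra.
Qed.

End independence.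

Section trig_sums.
Context {R : realType}.
Local Notation TR := (measurableTypeR R).

Lemma measurable_cosT : measurable_fun setT (cos : TR -> TR).
Proof. exact: (continuous_measurable_fun (@continuous_cos R)). Qed.

Lemma measurable_sinT : measurable_fun setT (sin : TR -> TR).
Proof. exact: (continuous_measurable_fun (@continuous_sin R)). Qed.

Lemma measurable_iter_odd k : measurable_fun setT (iter k odd_digits : TR -> TR).
Proof. by elim: k => [|k IH]; [exact: measurable_id|exact: (measurableT_comp
  measurable_odd_digits IH)]. Qed.

(** The digits of x split into infinitely many disjoint subsequences, the k-th one
    being read by [even_digits (iter k odd_digits x)]; the summands are therefore
    independent. *)
Definition indep_sum (a : nat -> TR -> R) (n : nat) (x : TR) : R :=
  \sum_(k < n) a k (even_digits (iter k odd_digits x)).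

Lemma indep_sumS a n x :
  indep_sum a n.+1 x = a 0 (even_digits x) + indep_sum (fun k => a k.+1) n (odd_digits x).
Proof.
rewrite /indep_sum big_ord_recl; congr (_ + _).
by apply: eq_bigr => k _; rewrite /= -iterSr.
Qed.

Lemma measurable_indep_sum a n : (forall k, measurable_fun setT (a k)) ->
  measurable_fun setT (indep_sum a n).
Proof.
move=> ma; apply: measurable_sum => k.
apply: (measurableT_comp (ma k)) => //.
exact: (measurableT_comp measurable_even_digits (measurable_iter_odd k)).
Qed.

(** Characteristic functions of independent sums multiply. Symmetric summands have
    real characteristic functions; only the vanishing of the mean sine is needed
    for the addition formulas to close up without complex exponentials. *)
Lemma mean_trig_indep_sum (a : nat -> TR -> R) n :
  (forall k, measurable_fun setT (a k)) -> (forall k, mean (sin \o a k) = 0) ->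
  mean (cos \o indep_sum a n) = \prod_(k < n) mean (cos \o a k) /\
  mean (sin \o indep_sum a n) = 0.
Proof.
have c1 (f : TR -> R) x : `|(cos \o f) x| <= 1 by exact: cos_max.
have s1 (f : TR -> R) x : `|(sin \o f) x| <= 1 by exact: sin_max.
have mc (f : TR -> R) : measurable_fun setT f -> measurable_fun setT (cos \o f).
  by move=> mf; exact: (measurableT_comp measurable_cosT mf).
have ms (f : TR -> R) : measurable_fun setT f -> measurable_fun setT (sin \o f).
  by move=> mf; exact: (measurableT_comp measurable_sinT mf).
elim: n a => [|n IH] a ma a0.
  have -> : indep_sum a 0 = cst 0 by apply/funext => x; rewrite /indep_sum big_ord0.
  rewrite big_ord0; split.
    rewrite (_ : cos \o cst 0 = cst 1); last by apply/funext => x /=; rewrite cos0.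
    exact: mean_cst.
  rewrite (_ : sin \o cst 0 = cst 0); last by apply/funext => x /=; rewrite sin0.
  exact: mean_cst.
have [IHc IHs] := IH (fun k => a k.+1) (fun k => ma k.+1) (fun k => a0 k.+1).
set b := indep_sum _ n in IHc IHs.
have mb : measurable_fun setT b by exact: measurable_indep_sum.
have sE : indep_sum a n.+1 = (fun x => a 0 (even_digits x) + b (odd_digits x)).
  by apply/funext => x; exact: indep_sumS.
have mp (f g : R -> R) : measurable_fun setT (f : TR -> TR) ->
  measurable_fun setT (g : TR -> TR) ->
    measurable_fun setT (fun x : TR => f (a 0 (even_digits x)) * g (b (odd_digits x))).
  move=> mf mg; apply: measurable_funM.
    exact: (measurableT_comp (measurableT_comp mf (ma 0)) measurable_even_digits).
  exact: (measurableT_comp (measurableT_comp mg mb) measurable_odd_digits).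
have b1 (f g : R -> R) : (forall x, `|f x| <= 1) -> (forall x, `|g x| <= 1) ->
    forall x : TR, `|f (a 0 (even_digits x)) * g (b (odd_digits x))| <= 1.
  by move=> f1 g1 x; rewrite normrM mulr_ile1.
have mC := measurable_cosT; have mS := measurable_sinT.
have C1 := @cos_max R; have S1 := @sin_max R.
split.
  rewrite big_ord_recl -IHc.
  transitivity (mean (fun x => cos (a 0 (even_digits x)) * cos (b (odd_digits x)) -
                               sin (a 0 (even_digits x)) * sin (b (odd_digits x)))).
    by congr mean; apply/funext => x; rewrite /= sE cosD.
  rewrite meanB//; [|exact: mp|exact: b1|exact: mp|exact: b1].
  rewrite (mean_prod (mc _ (ma 0)) (c1 _) (mc _ mb) (c1 _)).
  by rewrite (mean_prod (ms _ (ma 0)) (s1 _) (ms _ mb) (s1 _)) a0 mul0r subr0.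
transitivity (mean (fun x => sin (a 0 (even_digits x)) * cos (b (odd_digits x)) -
                            - (cos (a 0 (even_digits x)) * sin (b (odd_digits x))))).
  by congr mean; apply/funext => x; rewrite /= sE sinD opprK.
rewrite meanB//; [|exact: mp|exact: b1| |]; last 2 first.
- by apply: measurableT_comp => //; exact: mp.
- by move=> x; rewrite normrN; exact: b1.
rewrite (mean_prod (ms _ (ma 0)) (s1 _) (mc _ mb) (c1 _)) a0 mul0r sub0r.
transitivity (- (- mean (fun x => cos (a 0 (even_digits x)) * sin (b (odd_digits x))))).
  congr (- _); rewrite /mean -mulN1r -RintegralZl//; last first.
    by apply: integrable_le1; [exact: mp|exact: b1].
  by apply: eq_Rintegral => x _; rewrite mulN1r.
by rewrite opprK (mean_prod (mc _ (ma 0)) (c1 _) (ms _ mb) (s1 _)) IHs mulr0.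
Qed.

End trig_sums.

(** * Compound Poisson sums *)

Section discrete.
Context {R : realType}.
Local Notation TR := (measurableTypeR R).
Local Notation mu := (lebesgue01 R).

Lemma measurable_to_nat (N : TR -> nat) : (forall n, measurable (N @^-1` [set n])) ->
  measurable_fun setT N.
Proof.
move=> mN _ Y _; rewrite setTI.
rewrite (_ : N @^-1` Y = \bigcup_(n in Y) (N @^-1` [set n])).
  by apply: bigcup_measurable => n _; exact: mN.
by apply/seteqP; split => [x Yx|x [n Yn /= ->]]//; exists (N x).
Qed.

(** Inverse transform sampling: N x is the index n of the interval between
    consecutive partial sums of p that contains x. *)
Lemma discrete_variable (p : nat -> R) : (forall n, 0 <= p n) ->
  series p @ \oo --> (1 : R) ->
  exists N : TR -> nat, measurable_fun setT N /\
    forall n, mu (N @^-1` [set n]) = (p n)%:E.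
Proof.
move=> p0 p1.
pose c := series p.
have cS n : c n.+1 = c n + p n by rewrite /c seriesEnat/= big_nat_recr.
have c0 : c 0%N = 0 by rewrite /c seriesEnat/= big_nil.
have cnd : nondecreasing_seq c.
  by apply/nondecreasing_seqP => n; rewrite cS lerDl.
have cle1 n : c n <= 1 by rewrite -(cvg_lim _ p1)//; apply: nondecreasing_cvgn_le => //;
  apply/cvg_ex; exists (1 : R).
have cge0 n : 0 <= c n by rewrite -c0; exact: cnd.
pose S n : set TR := `[c n, c n.+1[%classic.
have mS n : measurable (S n) by exact: measurable_itv.
have Suniq m n x : S m x -> S n x -> m = n.
  wlog mn : m n / (m < n)%N => [hw|] Sm Sn.
    by case: (ltngtP m n) => // h; [exact: (hw m n)|apply/esym; exact: (hw n m)].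
  move: Sm Sn; rewrite /S/= !in_itv/= => /andP[_ h1] /andP[h2 _].
  by have := lt_le_trans h1 (le_trans (cnd _ _ mn) h2); rewrite ltxx.
pose N (x : TR) : nat := xget 0%N [set n | S n x].
have NS n x : S n x -> N x = n.
  by move=> Snx; apply: xget_unique => // m Smx; exact: Suniq Smx Snx.
have ex x : 0 <= x < 1 -> exists n, S n x.
  move=> /andP[x0 x1].
  have h : exists n, x < c n.
    have : \forall n \near \oo, x < c n by move: p1 => /cvgrPdist_lt /(_ (1 - x));
      rewrite subr_gt0 => /(_ x1); apply: filterS => n;
        rewrite ger0_norm ?subr_ge0// ltrD2l ltrN2.
    by move=> [n _ /(_ n (leqnn n))]; exists n.
  case: (ex_minnP h) => -[|n] hn hmin; first by move: hn; rewrite c0 ltNge x0.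
  exists n; rewrite /S/= in_itv/= hn andbT leNgt; apply/negP => /hmin.
  by rewrite ltnn.
have N0 x : (forall n, ~ S n x) -> N x = 0%N.
  by move=> h; rewrite /N xgetPN.
have NE n : N @^-1` [set n] = S n `|` (if n == 0%N then ~` (\bigcup_k S k) else set0).
  apply/seteqP; split => x /=.
    move=> Nn; have [[m Sm]|/forallNP h] := pselect (exists m, S m x).
      by left; rewrite -Nn (NS _ _ Sm).
    by right; rewrite -Nn (N0 _ h) eqxx => -[m _ /h].
  move=> [/NS//|]; case: eqP => // -> /= h.
  by apply: N0 => m Sm; apply: h; exists m.
exists N; split.
  apply: measurable_to_nat => n; rewrite NE; apply: measurableU => //.
  by case: ifP => _ //; apply: measurableC; exact: bigcupT_measurable.
move=> n; rewrite lebesgue01E; last first.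
  rewrite NE; apply: measurableU => //.
  by case: ifP => _ //; apply: measurableC; exact: bigcupT_measurable.
rewrite (_ : _ `&` _ = S n).
  rewrite lebesgue_measure_itv/= lte_fin cS ltrDl.
  case: ltP => [_|pn]; first by rewrite -EFinB [c n + _]addrC addrK.
  by congr EFin; apply/eqP; rewrite eq_le pn p0.
apply/seteqP; split => x /=.
  by rewrite in_itv/= => -[Nn /ex[m Sm]]; rewrite -Nn (NS _ _ Sm).
move=> Sn; split; first exact: NS.
move: Sn; rewrite /S/= !in_itv/= => /andP[h1 h2].
by rewrite (le_trans _ h1)//= (lt_le_trans h2).
Qed.

Lemma integral_discrete (N : TR -> nat) (p : nat -> R) (h : nat -> \bar R) :
  measurable_fun setT N -> (forall n, mu (N @^-1` [set n]) = (p n)%:E) ->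
  (forall n, 0 <= h n)%E ->
  (\int[mu]_x h (N x) = \sum_(n <oo) h n * (p n)%:E)%E.
Proof.
move=> mN Np h0.
have mF n : measurable (N @^-1` [set n]).
  by rewrite -[X in measurable X]setTI; exact: mN.
have UF : \bigcup_n (N @^-1` [set n]) = setT by apply/seteqP; split => // x _; exists (N x).
have mh : measurable_fun setT (fun x : TR => h (N x)) by exact: (measurableT_comp (f := h)).
rewrite -[X in (\int[_]_(x in X) _)%E]UF ge0_integral_bigcup//.
- apply: eq_eseriesr => n _.
  rewrite -Np -integral_cst//; apply: eq_integral => x; rewrite inE/= => ->//.
- by rewrite UF.
- by apply/trivIsetP => i j _ _ /eqP ij; apply/seteqP; split => // x [/= Ni Nj];
  apply: ij; rewrite -Ni -Nj.
Qed.

Definition poisson1 (n : nat) : R := expR (-1) / n`!%:R.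

Lemma series_poisson1 (k : R) :
  series (fun n => poisson1 n * k ^+ n) @ \oo --> expR (k - 1).
Proof.
rewrite (_ : series _ = fun n => expR (-1) * series (exp_coeff k) n); last first.
  apply/funext => n; rewrite !seriesEnat/= big_distrr/=; apply: eq_bigr => i _.
  by rewrite /poisson1 /exp_coeff/= mulrAC mulrA mulrC.
rewrite expRD mulrC; apply: cvgM; first exact: cvg_cst.
exact: is_cvg_series_exp_coeff.
Qed.

Lemma eseries_EFin (u : nat -> R) (l : R) : series u @ \oo --> l ->
  (\sum_(n <oo) (u n)%:E = l%:E)%E.
Proof.
move=> ul; apply: cvg_lim => //.
apply/fine_cvgP; split.
  by apply: nearW => n; rewrite sumEFin.
apply: cvg_trans ul; apply: near_eq_cvg; apply: nearW => n /=.
by rewrite seriesEnat/= sumEFin.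
Qed.

(** The preimage splits according to the countably many values of the index. *)
Lemma measurable_random_index (N : TR -> nat) (g : nat -> TR -> R) :
  measurable_fun setT N -> (forall n, measurable_fun setT (g n)) ->
  measurable_fun setT (fun z : TR * TR => g (N z.1) z.2).
Proof.
move=> mN mg _ Y mY; rewrite setTI.
rewrite (_ : _ @^-1` Y = \bigcup_n ((N @^-1` [set n]) `*` (g n @^-1` Y))).
  apply: bigcupT_measurable => n; apply: measurableX.
    by rewrite -[X in measurable X]setTI; exact: mN.
  by rewrite -[X in measurable X]setTI; exact: mg.
apply/seteqP; split => [[x y] /= Yz|[x y] [n _ [/= -> Yz]]]//.
by exists (N x).
Qed.

Lemma poisson_variable : exists N : TR -> nat, measurable_fun setT N /\
    forall n, mu (N @^-1` [set n]) = (poisson1 n)%:E.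
Proof.
apply: discrete_variable.
- by move=> n; rewrite /poisson1 divr_ge0// expR_ge0.
- have := @series_poisson1 1; rewrite subrr expR0.
  by under eq_fun do rewrite expr1n mulr1.
Qed.

(** Given N = n, the mean cosine of the sum of n independent copies of a is m^n,
    where m is the mean cosine of a; averaging m^n over the Poisson law gives
    exp(m - 1). *)
Lemma mean_trig_compound (N : TR -> nat) (a : TR -> R) :
  measurable_fun setT N -> (forall n, mu (N @^-1` [set n]) = (poisson1 n)%:E) ->
  measurable_fun setT a -> mean (sin \o a) = 0 ->
  let Y := fun x => indep_sum (fun=> a) (N (even_digits x)) (odd_digits x) in
  [/\ measurable_fun setT Y, mean (cos \o Y) = expR (mean (cos \o a) - 1)
    & mean (sin \o Y) = 0].
Proof.
move=> mN Np ma sa Y.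
have mG : measurable_fun setT (fun z : TR * TR => indep_sum (fun=> a) (N z.1) z.2).
  by apply: measurable_random_index => // n; exact: measurable_indep_sum.
have mY : measurable_fun setT Y by exact: (measurableT_comp mG measurable_digits).
have H n := mean_trig_indep_sum n (fun _ : nat => ma) (fun=> sa).
have c1 (f : TR -> R) x : `|(cos \o f) x| <= 1 by exact: cos_max.
have s1 (f : TR -> R) x : `|(sin \o f) x| <= 1 by exact: sin_max.
have mc (f : TR -> R) : measurable_fun setT f -> measurable_fun setT (cos \o f).
  by move=> mf; exact: (measurableT_comp measurable_cosT mf).
have ms (f : TR -> R) : measurable_fun setT f -> measurable_fun setT (sin \o f).
  by move=> mf; exact: (measurableT_comp measurable_sinT mf).
have nn (x : R) : `|x| <= 1 -> 0 <= 1 + x.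
  by rewrite -lerBlDl sub0r ler_norml => /andP[].
split => //.
- apply: mean_unique => //; first exact: mc.
  transitivity (\int[mu]_x (fun z : TR * TR => (1 + cos (indep_sum (fun=> a) (N z.1)
    z.2))%:E) (even_digits x, odd_digits x))%E; first by [].
  rewrite (@integral_digits _ (fun z : TR * TR => (1 + cos (indep_sum (fun=> a) (N z.1)
    z.2))%:E)); last 2 first.
  - apply/measurable_EFinP; apply: measurable_funD => //.
    exact: (measurableT_comp measurable_cosT mG).
  - by move=> z; rewrite lee_fin nn// cos_max.
  transitivity (\int[mu]_x (fun n => (1 + mean (cos \o a) ^+ n)%:E) (N x))%E.
    apply: eq_integral => x _ /=.
    rewrite (@integral1D _ (cos \o indep_sum (fun=> a) (N x)))//; last first.
      by apply: mc; exact: measurable_indep_sum.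
    by rewrite (H (N x)).1 prodr_const card_ord.
  rewrite (@integral_discrete _ poisson1 (fun n => (1 + mean (cos \o a) ^+ n)%:E))//; last first.
    by move=> n; rewrite lee_fin nn// normrX exprn_ile1// mean_le1//; exact: mc.
  under eq_eseriesr do rewrite -EFinM.
  apply: eseries_EFin.
  rewrite (_ : series _ = (fun n => series poisson1 n + series (fun n => poisson1 n *
    mean (cos \o a) ^+ n) n)); last first.
    apply/funext => n; rewrite !seriesEnat/= -big_split/=; apply: eq_bigr => i _.
    by rewrite mulrDl mul1r mulrC.
  apply: cvgD; last exact: series_poisson1.
  have := @series_poisson1 1; rewrite subrr expR0.
  by under eq_fun do rewrite expr1n mulr1.
- apply: mean_unique => //; first exact: ms.
  transitivity (\int[mu]_x (fun z : TR * TR => (1 + sin (indep_sum (fun=> a) (N z.1)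
    z.2))%:E) (even_digits x, odd_digits x))%E; first by [].
  rewrite (@integral_digits _ (fun z : TR * TR => (1 + sin (indep_sum (fun=> a) (N z.1)
    z.2))%:E)); last 2 first.
  - apply/measurable_EFinP; apply: measurable_funD => //.
    exact: (measurableT_comp measurable_sinT mG).
  - by move=> z; rewrite lee_fin nn// sin_max.
  transitivity (\int[mu]_x (1%:E : \bar R))%E; last by rewrite integral01_cst addr0.
  apply: eq_integral => x _ /=.
  rewrite (@integral1D _ (sin \o indep_sum (fun=> a) (N x)))//; last first.
    by apply: ms; exact: measurable_indep_sum.
  by rewrite (H (N x)).2 addr0.
Qed.

End discrete.

(** * The line as a union of shells *)

Section shells.
Context {R : realType}.
Local Notation leb := (@lebesgue_measure R).
Local Notation TR := (measurableTypeR R).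
Local Notation mu := (lebesgue01 R).

(** A point spread uniformly over the two intervals [k, k+1] and [-k-1, -k]. *)
Definition shell (k : nat) (x : TR) : TR :=
  if digit x then k%:R + doubling x else - (k%:R + doubling x).

Lemma measurable_shell k : measurable_fun setT (shell k).
Proof.
have md : measurable_fun setT (fun x : TR => k%:R + doubling x).
  by apply: measurable_funD => //; exact: measurable_doubling.
apply: measurable_fun_ifT => //; first exact: measurable_digit.
exact: measurableT_comp.
Qed.

Let mpos k : measurable_fun setT (fun x : TR => (k%:R + x : TR)).
Proof. exact: measurable_funD. Qed.

Let mneg k : measurable_fun setT (fun x : TR => (- (k%:R + x) : TR)).
Proof. by apply: measurableT_comp => //; exact: mpos. Qed.

Let half : {nonneg R} := NngNum (ltW (divr_gt0 ltr01 (ltr0n R 2))).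

Lemma shell_law k (A : set TR) : measurable A ->
  (mu (shell k @^-1` A) = (2^-1)%:E * mu ((fun x : R => (- (k%:R + x))%R) @^-1` A)
    + (2^-1)%:E * mu ((fun x : R => (k%:R + x)%R) @^-1` A))%E.
Proof.
move=> mA.
pose B (b : bool) : set TR := if b then (fun x : R => k%:R + x) @^-1` A
  else (fun x : R => - (k%:R + x)) @^-1` A.
have -> : shell k @^-1` A = [set x | B (digit x) (doubling x)].
  by apply/seteqP; split => x; rewrite /B /shell/=; case: (digit x).
rewrite lebesgue01_doubling// => -[]; rewrite /B.
  by rewrite -[X in measurable X]setTI; exact: mpos.
by rewrite -[X in measurable X]setTI; exact: mneg.
Qed.

Lemma integral_shell k (F : TR -> \bar R) : measurable_fun setT F ->
  (forall x, 0 <= F x)%E ->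
  (\int[mu]_x F (shell k x) = (2^-1)%:E * \int[mu]_x F (- (k%:R + x))%R
    + (2^-1)%:E * \int[mu]_x F (k%:R + x)%R)%E.
Proof.
move=> mF F0.
rewrite -(integral_image mu (measurable_shell k))//.
rewrite -(integral_image mu (mpos k))// -(integral_image mu (mneg k))//.
transitivity (\int[measure_add (mscale half (image_measure mu (mneg k))) (mscale half
  (image_measure mu (mpos k)))]_x F x)%E.
  apply: eq_measure_integral => A mA _.
  apply: (eq_trans _ (esym (measure_addE _ _ _))); rewrite /= /mscale/= /pushforward.
  have -> : (1 / 2)%R = 2^-1 :> R by rewrite mul1r.
  exact: shell_law.
rewrite ge0_integral_measure_add// !ge0_integral_mscale//=.
by have -> : (1 / 2)%R = 2^-1 :> R by rewrite mul1r.
Qed.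

(** The k-th shell variable is uniform on a set of length 2, and these sets tile
    the line up to the integers. *)
Lemma series_shell (A : set TR) : measurable A ->
  (\sum_(k <oo) mu (shell k @^-1` A) = (2^-1)%:E * leb A)%E.
Proof.
move=> mA.
have mO (B : set TR) : measurable B -> measurable ((fun x : TR => (- x)%R : TR) @^-1` B).
  by move=> mB; rewrite -[X in measurable X]setTI; apply: oppr_measurable.
have ray (B : set TR) : measurable B ->
    (\sum_(k <oo) mu ((fun x : R => (k%:R + x)%R) @^-1` B) = leb (B `&` `[0%R, +oo[))%E.
  move=> mB; pose F k : set TR := B `&` `[k%:R, k.+1%:R[.
  have mF k : measurable (F k) by exact: measurableI.
  have -> : B `&` `[0%R, +oo[ = \bigcup_k F k.
    rewrite -setI_bigcupr; congr (_ `&` _); apply/seteqP; split => x /=.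
      rewrite in_itv/= andbT => x0; exists (Num.truncn x) => //=.
      by rewrite in_itv/= truncn_itv.
    by move=> [k _]/=; rewrite !in_itv/= andbT => /andP[h _]; rewrite (le_trans _ h).
  rewrite measure_semi_bigcup//; last 2 first.
  - apply/trivIsetP => i j _ _ ij; apply/seteqP; split => // x [[_ +] [_ +]].
    rewrite /= !in_itv/= => /andP[h1 h2] /andP[h3 h4].
    have := le_lt_trans h1 h4; have := le_lt_trans h3 h2; rewrite !ltr_nat !ltnS => a b.
    by move: ij; rewrite eqn_leq a b.
  - exact: bigcupT_measurable.
  apply: eq_eseriesr => k _.
  have mk : measurable ((fun x : TR => (k%:R + x)%R : TR) @^-1` B).
    by rewrite -[X in measurable X]setTI; exact: mpos.
  rewrite lebesgue01E//.
  apply/esym; apply: (eq_trans (@lebesgue_affine_pos _ 1 k%:R _ ltr01 (mF k))).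
  rewrite mul1e; congr (leb _); apply/seteqP; split => x /=; rewrite /F/= !in_itv/= mul1r addrC.
    by rewrite -natr1 => -[? /andP[? ?]]; split=> //; apply/andP; split; lra.
  by rewrite -natr1 => -[? /andP[? ?]]; split=> //; apply/andP; split; lra.
under eq_eseriesr do rewrite shell_law//.
rewrite nneseriesD; last 2 first.
- by move=> k _; rewrite mule_ge0.
- by move=> k _; rewrite mule_ge0.
rewrite !nneseriesZl//.
have -> : (\sum_(k <oo) mu ((fun x : R => (- (k%:R + x))%R) @^-1` A) = leb (A `&` `]-oo, 0%R]))%E.
  rewrite (_ : (fun _ => _) = (fun n => (\sum_(0 <= k < n) mu ((fun x : R => (k%:R +
    x)%R) @^-1` ((fun x => (- x)%R) @^-1` A)))%E)) ?ray//.
  - apply/esym; apply: (eq_trans (esym (lebesgue_measureN (measurableI _ _ mA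
    (measurable_itv _))))).
    rewrite /pushforward; congr (leb _); apply/seteqP; split => x /=;
      rewrite !in_itv/= ?andbT oppr_le0//.
  - exact: mO.
rewrite ray// -ge0_muleDr//.
congr (_ * _)%E.
have -> : leb (A `&` `[0%R, +oo[) = leb (A `&` `]0%R, +oo[).
  apply/eqP; rewrite eq_le; apply/andP; split; last first.
    rewrite le_measure ?inE//; try exact: measurableI.
    by apply: setIS => x /=; rewrite !in_itv/= !andbT => /ltW.
  apply: (@le_trans _ _ (leb ((A `&` `]0%R, +oo[) `|` [set 0%R]))).
    rewrite le_measure ?inE//; try exact: measurableI.
      by apply: measurableU; [exact: measurableI|exact: measurable_set1].
    move=> x [Ax]/=; rewrite in_itv/= andbT le_eqVlt => /orP[/eqP <-|x1].
      by right.
    by left; split => //; rewrite /= in_itv/= x1.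
  apply: (le_trans (measureU2 _ _ _)) => //; first exact: measurableI.
  by rewrite [X in (_ + X)%E](_ : _ = 0%E) ?adde0//; exact: lebesgue_measure_set1.
rewrite -measureU//; [|exact: measurableI|exact: measurableI|].
  congr (leb _); rewrite -setIUr; apply/seteqP; split => [x []//|x Ax]; split => //.
  by rewrite /= !in_itv/= andbT; case: (leP x 0); [left|right].
apply/seteqP; split => // x [[_ +] [_ +]]; rewrite /= !in_itv/= andbT.
by rewrite leNgt => /negbTE ->.
Qed.

End shells.

(** * Averaging over scales *)

Section constants.
Context {R : realType}.
Local Notation leb := (@lebesgue_measure R).
Local Notation TR := (measurableTypeR R).

Let dist_le_of_derive (f df : R -> R) : (forall x : R, is_derive x 1 f (df x)) ->
  (forall x, `|df x| <= 1) -> forall x y : R, `|f x - f y| <= `|x - y|.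
Proof.
move=> fd df1 x y; wlog xy : x y / y <= x => [hw|].
  by case: (leP y x) => [/hw//|/ltW/hw]; rewrite distrC [`|y - x|]distrC.
have cf : {within `[y, x], continuous f}.
  apply: continuous_subspaceT => z; apply/differentiable_continuous/derivable1_diffP.
  by case: (fd z).
have [c _ ->] := MVT_segment xy (fun z _ => fd z) cf.
by rewrite normrM ler_piMl.
Qed.

Lemma cos_dist (x y : R) : `|cos x - cos y| <= `|x - y|.
Proof.
apply: (@dist_le_of_derive cos (fun x => - sin x)) => z.
by rewrite normrN sin_max.
Qed.

Lemma sin_norm_le (x : R) : `|sin x| <= `|x|.
Proof.
by have := @dist_le_of_derive sin cos _ (@cos_max R) x 0; rewrite sin0 !subr0; apply.
Qed.

Lemma cos_sub1E (x : R) : 1 - cos x = 2 * sin (x / 2) ^+ 2.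
Proof.
have -> : cos x = cos ((x / 2) *+ 2) by rewrite -mulr_natr divfK.
rewrite cos_mulr2n cos2sin2; ring.
Qed.

Lemma cos_sub1_ge0 (x : R) : 0 <= 1 - cos x.
Proof. by rewrite subr_ge0 cos_le1. Qed.

Lemma cos_sub1_le (x : R) : 1 - cos x <= 2 * Num.min 1 (`|x| `^ 2).
Proof.
rewrite minr_pMr// mulr1 le_min; apply/andP; split.
  by have := cos_geN1 x; lra.
rewrite cos_sub1E ler_wpM2l//.
rewrite powR_mulrn// -(real_normK (num_real (sin _))).
rewrite lerXn2r ?nnegrE// (le_trans (sin_norm_le _))// normrM ler_piMr//.
by rewrite ger0_norm ?invr_ge0// invf_le1// ler1n.
Qed.

Lemma cos_sub1_gt0 (x : R) : 0 < x <= 2 -> 0 < 1 - cos x.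
Proof.
move=> /andP[x0 x2]; rewrite cos_sub1E mulr_gt0// exprn_gt0// sin2_gt0//.
by rewrite divr_gt0//=; lra.
Qed.

(** The interval [1, 2] stands for any fixed set of positive measure on which
    positivity is easy to check. *)
Lemma integral_gt0_on12 (F : TR -> \bar R) : measurable_fun setT F ->
  (forall x, 0 <= F x)%E -> (forall x : R, (1 <= x <= 2)%R -> 0 < F x)%E ->
  (0 < \int[leb]_x F x)%E.
Proof.
move=> mF F0 F1; rewrite lt_neqAle integral_ge0// andbT; apply/eqP => h.
have : (\int[leb]_(x in setT) `|F x| = 0)%E.
  by rewrite [RHS]h; apply: eq_integral => x _; rewrite gee0_abs.
move/(ae_eq_integral_abs leb measurableT mF) => [N [mN N0 sN]].
have : (leb (`[1%R, 2%R]%classic : set TR) <= leb N)%E.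
  rewrite le_measure ?inE//.
  move=> x /=; rewrite in_itv/= => x12; apply: sN => /= /(_ I) Fx.
  by have := F1 x x12; rewrite Fx ltxx.
rewrite [X in (_ <= X)%E]N0 lebesgue_measure_itv/= lte_fin ltr1n -EFinB.
by rewrite lee_fin leNgt => /negP; apply; lra.
Qed.

Lemma integral_weight_lty (q r C : R) (F : TR -> R) : 0 < q -> q < r ->
  measurable_fun setT F -> (forall x, 0 <= F x <= C * Num.min 1 (`|x| `^ r)) ->
  (\int[leb]_x (F x * `|x| `^ (- (1 + q)))%:E < +oo)%E.
Proof.
move=> q0 qr mF FC.
have C0 : 0 <= C.
  have /andP[h1 h2] := FC 1; have := le_trans h1 h2.
  by rewrite normr1 powR1 minxx mulr1.
apply: (@le_lt_trans _ _ (\int[leb]_x (C%:E * (Num.min 1 (`|x| `^ r) * `|x| `^ (- (1 +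
  q)))%:E))%E).
  apply: ge0_le_integral => //.
  - by move=> x _; rewrite lee_fin mulr_ge0 ?powR_ge0//; have /andP[] := FC x.
  - by apply/measurable_EFinP; apply: measurable_funM => //; exact: measurable_powabs.
  - apply: measurable_funeM; apply/measurable_EFinP; apply: measurable_funM;
    last exact: measurable_powabs.
    by apply: measurable_minr => //; exact: measurable_powabs.
  - move=> x _; rewrite -EFinM lee_fin mulrA ler_wpM2r ?powR_ge0//.
    by have /andP[] := FC x.
rewrite ge0_integralZl//.
  by rewrite lte_mul_pinfty// ?lee_fin// integral_min_powR_lty.
apply/measurable_EFinP; apply: measurable_funM; last exact: measurable_powabs.
by apply: measurable_minr => //; exact: measurable_powabs.
Qed.

(** By homogeneity the integral is |a|^q times its value K at a = 1; K is finite
    since F is bounded and is O(|x|^r) at 0, and positive since F is positive on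
    [1, 2]. This is the origin of all power laws below: F is 1 - cos for absolute
    moments, 1 - exp(-|x|^p) for the moments of a stable law, and the L_p modulus
    of continuity of a tent function for the kernel. *)
Lemma scale_average (q r C : R) (F : TR -> R) : 0 < q -> q < r ->
  measurable_fun setT F -> (forall x, 0 <= F x <= C * Num.min 1 (`|x| `^ r)) ->
  (forall x, 1 <= x <= 2 -> 0 < F x) ->
  exists2 K : R, 0 < K & forall a : R,
    (\int[leb]_x (F (a * x) * `|x| `^ (- (1 + q)))%:E = (K * `|a| `^ q)%:E)%E.
Proof.
move=> q0 qr mF FC F12.
pose I := (\int[leb]_x (F x * `|x| `^ (- (1 + q)))%:E)%E.
have Ioo : (I < +oo)%E by exact: (integral_weight_lty q0 qr mF FC).
have mFw : measurable_fun setT (fun x : TR => (F x * `|x| `^ (- (1 + q)))%:E).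
  by apply/measurable_EFinP; apply: measurable_funM => //; exact: measurable_powabs.
have F0 x : 0 <= F x by have /andP[] := FC x.
have Fz : F 0 = 0.
  have /andP[h1 h2] := FC 0; apply/eqP; rewrite eq_le h1 andbT (le_trans h2)//.
  by rewrite normr0 powR0 ?gt_eqF// ?(lt_trans q0)// min_r ?mulr0.
have I0 : (0 < I)%E.
  apply: integral_gt0_on12 => //.
    by move=> x; rewrite lee_fin mulr_ge0 ?powR_ge0.
  move=> x x12; rewrite lte_fin mulr_gt0 ?F12// powR_gt0// normr_gt0.
  by apply/eqP => x0; move: x12; rewrite x0 ler10.
exists (fine I); first by rewrite fine_gt0// I0 Ioo.
move=> a.
have := @integral_homogeneous0 R q a (EFin \o F) (lt0r_neq0 q0).
rewrite /= Fz => /(_ erefl) h.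
under eq_integral do rewrite EFinM.
rewrite h//; last by apply/measurable_EFinP.
under eq_integral do rewrite -EFinM.
by rewrite -/I EFinM fineK 1?muleC// ge0_fin_numE// ltW.
Qed.

(** The Levy-Khintchine exponent of the symmetric p-stable law: y -> |y|^(-1/p)
    carries Lebesgue measure to the Levy density, a multiple of |x|^-(1 + p).
    Scaling y gives the factor |b|^p, and p < 2 makes the integral converge at
    infinity, where 1 - cos (|y|^(-1/p)) is at most |y|^(-2/p). *)
Lemma stable_exponent (p : R) : 0 < p -> p < 2 ->
  exists2 K : R, 0 < K & forall b : R,
    (\int[leb]_y (1 - cos (`|y| `^ (- p^-1) * b))%:E = (K * `|b| `^ p)%:E)%E.
Proof.
move=> p0 p2.
pose F (y : TR) := 1 - cos (`|y| `^ (- p^-1)).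
have mF : measurable_fun setT F.
  apply: measurable_funB => //; apply: (measurableT_comp (@measurable_cosT R)).
  exact: measurable_powabs.
have F0 x : 0 <= F x by exact: cos_sub1_ge0.
pose I := (\int[leb]_y (F y)%:E)%E.
have I0 : (0 < I)%E.
  apply: integral_gt0_on12 => //; first exact/measurable_EFinP.
  move=> x /andP[x1 x2]; rewrite lte_fin cos_sub1_gt0//.
  have xp : 0 < x by rewrite (lt_le_trans _ x1).
  rewrite gtr0_norm// powR_gt0//= powRN.
  apply: (@le_trans _ _ 1); last by rewrite ler1n.
  have h1 : (1 : R) `^ p^-1 = 1 by rewrite powR1.
  rewrite invf_le1 ?powR_gt0// -[leLHS]h1; apply: ge0_ler_powR => //.
  - by rewrite invr_ge0 ltW.
  - by rewrite nnegrE.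
  - by rewrite nnegrE ltW.
have Ioo : (I < +oo)%E.
  have q0 : 0 < 2 / p - 1 by rewrite subr_gt0 ltr_pdivlMr// mul1r.
  have qr : 2 / p - 1 < 2 / p by rewrite gtrBl.
  apply: (@le_lt_trans _ _ (\int[leb]_x (2%:E * (Num.min 1 (`|x| `^ (2 / p)) * `|x| `^ (-
    (1 + (2 / p - 1))))%:E))%E).
    apply: ge0_le_integral => //.
    - by move=> x _; rewrite lee_fin.
    - exact/measurable_EFinP.
    - apply: measurable_funeM; apply/measurable_EFinP; apply: measurable_funM;
      last exact: measurable_powabs.
      by apply: measurable_minr => //; exact: measurable_powabs.
    - move=> x _; rewrite -EFinM lee_fin /F (_ : 1 + (2 / p - 1) = 2 / p);
      last by rewrite addrC subrK.
      have [->|x0] := eqVneq x 0.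
        by rewrite normr0 !powR0 ?oppr_eq0 ?invr_eq0 ?gt_eqF ?divr_gt0// cos0 subrr mulr0 mulr0.
      have xp : 0 < `|x| by rewrite normr_gt0.
      apply: (le_trans (cos_sub1_le _)); rewrite ler_wpM2l// minr_pMl ?powR_ge0//.
      rewrite mul1r -powRD ?subrr ?powRr0; last by rewrite (gt_eqF xp) implybT.
      by rewrite ger0_norm ?powR_ge0// -powRrM mulNr mulrC minC.
  rewrite ge0_integralZl//.
    by rewrite lte_mul_pinfty// integral_min_powR_lty.
  apply/measurable_EFinP; apply: measurable_funM; last exact: measurable_powabs.
  by apply: measurable_minr => //; exact: measurable_powabs.
exists (fine I); first by rewrite fine_gt0// I0 Ioo.
move=> b; have [->|b0] := eqVneq b 0.
  under eq_integral do rewrite mulr0 cos0 subrr.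
  by rewrite integral0 normr0 powR0 ?mulr0// gt_eqF.
have bp : 0 < `|b| by rewrite normr_gt0.
have aN0 : `|b| `^ (- p) != 0 by rewrite gt_eqF// powR_gt0.
have h := @integral_affine R (`|b| `^ (- p)) 0 (EFin \o F) aN0.
transitivity (\int[leb]_x (EFin \o F) (`|b| `^ (- p) * x + 0)%R)%E.
  apply: eq_integral => y _; rewrite /= /F addr0 normrM ger0_norm ?powR_ge0//.
  rewrite powRM ?powR_ge0// -powRrM mulrNN divff ?gt_eqF// powRr1//.
  rewrite [in RHS]mulrC; congr (1 - _)%:E.
  by case: (ger0P b) => // _; rewrite mulrN cosN.
rewrite h//; last exact/measurable_EFinP.
rewrite -/I ger0_norm ?powR_ge0// powRN invrK muleC EFinM fineK//.
by rewrite ge0_fin_numE// ltW.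
Qed.

End constants.

(** * Partial sums of a stable process *)

Section levy.
Context {R : realType}.
Local Notation leb := (@lebesgue_measure R).
Local Notation TR := (measurableTypeR R).
Local Notation mu := (lebesgue01 R).

Let half : {nonneg R} := NngNum (ltW (divr_gt0 ltr01 (ltr0n R 2))).

(** [series_shell] as an identity between a series of measures and a multiple of
    Lebesgue measure. *)
Lemma integral_series_shell (F : TR -> \bar R) : measurable_fun setT F ->
  (forall x, 0 <= F x)%E ->
  (\sum_(k <oo) \int[mu]_x F (shell k x) = (2^-1)%:E * \int[leb]_x F x)%E.
Proof.
move=> mF F0.
have hE : (1 / 2)%R = 2^-1 :> R by rewrite mul1r.
have <- : (\int[mscale half leb]_x F x = (2^-1)%:E * \int[leb]_x F x)%E.
  by rewrite ge0_integral_mscale// -hE.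
have <- : (\int[mseries (fun k => image_measure mu (measurable_shell k)) 0]_x F x =
    \sum_(k <oo) \int[mu]_x F (shell k x))%E.
  rewrite (ge0_integral_measure_series _ measurableT (fun t _ => F0 t) mF).
  by apply: eq_eseriesr => k _; rewrite integral_image.
apply: eq_measure_integral => A mA _.
transitivity (\sum_(k <oo) mu (shell k @^-1` A))%E; first by [].
by rewrite series_shell// -hE.
Qed.

(** Pick the n-th shell with its Poisson probability, which is never 0, then a
    point of it uniformly, and let the weight w be 2 over that probability. *)
Lemma line_from_unit : exists tau w : TR -> TR,
  [/\ measurable_fun setT tau, measurable_fun setT w, forall x, 0 < w x &
    forall F : TR -> \bar R, measurable_fun setT F -> (forall x, 0 <= F x)%E ->
    (\int[leb]_x F x = \int[mu]_x (F (tau x) * (w x)%:E))%E].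
Proof.
have [N [mN Np]] := @poisson_variable R.
pose wt n : R := 2 / poisson1 n.
have p0 n : 0 < poisson1 n :> R by rewrite /poisson1 divr_gt0 ?expR_gt0// ltr0n fact_gt0.
have wt0 n : 0 < wt n by rewrite divr_gt0.
have mt : measurable_fun setT (fun z : TR * TR => shell (N z.1) z.2 : TR).
  by apply: measurable_random_index => // n; exact: measurable_shell.
have mw : measurable_fun setT (fun z : TR * TR => wt (N z.1) : TR).
  by apply: (@measurable_random_index _ N (fun n => cst (wt n))).
exists (fun x => shell (N (even_digits x)) (odd_digits x)), (fun x => wt (N (even_digits x))).
split => //.
- exact: (measurableT_comp mt measurable_digits).
- exact: (measurableT_comp mw measurable_digits).
move=> F mF F0.
transitivity (\int[mu]_x (fun z : TR * TR => F (shell (N z.1) z.2) * (wt (N z.1))%:E)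
  (even_digits x, odd_digits x))%E; last by [].
rewrite (@integral_digits _ (fun z : TR * TR => F (shell (N z.1) z.2) * (wt (N
  z.1))%:E)%E); last 2 first.
- apply: emeasurable_funM; last exact/measurable_EFinP.
  exact: (measurableT_comp mF mt).
- by move=> z; rewrite mule_ge0// lee_fin ltW.
transitivity (\int[mu]_x (fun n => (wt n)%:E * \int[mu]_y F (shell n y)) (N x))%E; last first.
  apply: eq_integral => x _ /=; under [RHS]eq_integral do rewrite muleC.
  rewrite ge0_integralZl//; first by exact: (measurableT_comp mF (measurable_shell _)).
  by rewrite lee_fin ltW.
rewrite (@integral_discrete _ N poisson1 (fun n => (wt n)%:E * \int[mu]_y F (shell n
  y))%E)//; last first.
  by move=> n; apply: mule_ge0; [rewrite lee_fin ltW|exact: integral_ge0].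
transitivity (\sum_(n <oo) (2%:E * \int[mu]_y F (shell n y)))%E; last first.
  apply: eq_eseriesr => n _; rewrite muleAC -EFinM /wt divfK//.
  by rewrite gt_eqF.
rewrite nneseriesZl//; last by move=> n _; exact: integral_ge0.
by rewrite integral_series_shell// muleA -EFinM divff// mul1e.
Qed.

Variable (p : R).
Hypothesis p0 : 0 < p.
Hypothesis p2 : p < 2.

Implicit Types f g : TR -> R.

(** The jump attached to the point y of the line: the image of Lebesgue measure is
    the Levy measure of the symmetric p-stable law. *)
Definition jump_size (y : TR) : TR := Num.sg y * `|y| `^ (- p^-1).

Lemma measurable_sg : measurable_fun setT (Num.sg : TR -> TR).
Proof.
rewrite (_ : Num.sg = fun x : TR => if x < 0 then -1 else if x == 0 then 0 else 1); last first.
  apply/funext => x; case: (ltgtP x 0) => [x0|x0|->].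
  - by rewrite ltr0_sg.
  - by rewrite gtr0_sg.
  - by rewrite sgr0.
apply: measurable_fun_ifT => //; first exact: measurable_fun_ltr.
by apply: measurable_fun_ifT => //; exact: measurable_fun_eqr.
Qed.

Lemma measurable_jump_size : measurable_fun setT jump_size.
Proof. by apply: measurable_funM; [exact: measurable_sg|exact: measurable_powabs]. Qed.

Lemma jump_sizeN y : jump_size (- y) = - jump_size y.
Proof. by rewrite /jump_size sgrN normrN mulNr. Qed.

Lemma cos_jump_size y c : cos (jump_size y * c) = cos (`|y| `^ (- p^-1) * c).
Proof.
rewrite /jump_size; have [->|y0] := eqVneq y 0.
  by rewrite sgr0 normr0 powR0 ?mul0r// oppr_eq0 invr_eq0 gt_eqF.
by rewrite -mulrA cos_sg.
Qed.

(** One jump from the k-th shell, the odd digits of x serving as its mark. *)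
Definition jump (k : nat) f (x : TR) : TR :=
  jump_size (shell k (even_digits x)) * f (odd_digits x).

Let mjs k : measurable_fun setT (fun z : TR => jump_size (shell k z)).
Proof. exact: (measurableT_comp measurable_jump_size (measurable_shell k)). Qed.

Let mjump2 k f : measurable_fun setT f ->
  measurable_fun setT (fun z : TR * TR => jump_size (shell k z.1) * f z.2 : TR).
Proof.
move=> mf; apply: measurable_funM.
  exact: (measurableT_comp (mjs k) measurable_fst).
exact: (measurableT_comp mf measurable_snd).
Qed.

Lemma measurable_jump k f : measurable_fun setT f -> measurable_fun setT (jump k f).
Proof. by move=> mf; exact: (measurableT_comp (mjump2 k mf) measurable_digits). Qed.

(** The shell is symmetric and the jump size is odd, so the integrands 1 + sin and
    1 - sin of opposite points add up to 2. *)
Lemma mean_sin_jump k f : measurable_fun setT f -> mean (sin \o jump k f) = 0.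
Proof.
move=> mf.
have nn (x : R) : (0 <= (1 + sin x)%:E)%E.
  by rewrite lee_fin -lerBlDl sub0r sin_geN1.
apply: mean_unique.
- exact: (measurableT_comp (@measurable_sinT R) (measurable_jump k mf)).
- by move=> x; exact: sin_max.
pose G (z : TR * TR) := (1 + sin (jump_size (shell k z.1) * f z.2))%:E.
have mG : measurable_fun setT G.
  apply/measurable_EFinP; apply: measurable_funD => //.
  exact: (measurableT_comp (@measurable_sinT R) (mjump2 k mf)).
transitivity (\int[mu]_x G (even_digits x, odd_digits x))%E; first by [].
rewrite integral_digits//; last by move=> z; exact: nn.
rewrite [LHS](@fubini_tonelli _ _ _ _ _ mu mu G)//; last by move=> z; exact: nn.
transitivity (\int[mu]_y (1%:E : \bar R))%E; last by rewrite integral01_cst addr0.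
apply: eq_integral => t _; rewrite /G/=.
pose F (y : TR) := (1 + sin (jump_size y * f t))%:E.
have mF1 : measurable_fun setT (fun y : TR => sin (jump_size y * f t)).
  apply: (measurableT_comp (@measurable_sinT R)).
  by apply: measurable_funM => //; exact: measurable_jump_size.
have mF : measurable_fun setT F.
  by apply/measurable_EFinP; exact: measurable_funD.
transitivity (\int[mu]_x F (shell k x))%E; first by [].
have mk : measurable_fun setT (fun x : TR => k%:R + x : TR) by exact: measurable_funD.
rewrite integral_shell//; last by move=> y; exact: nn.
have mFk : measurable_fun setT (fun x : TR => F (k%:R + x)) by exact: (measurableT_comp mF mk).
have mFn : measurable_fun setT (fun x : TR => F (- (k%:R + x))).
  by apply: (measurableT_comp mF); exact: measurableT_comp.
rewrite -ge0_muleDr; last 2 first.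
- by apply: integral_ge0 => y _; exact: nn.
- by apply: integral_ge0 => y _; exact: nn.
rewrite -ge0_integralD//; last 2 first.
- by move=> y _; exact: nn.
- by move=> y _; exact: nn.
transitivity ((2^-1)%:E * \int[mu]_y (2%:E : \bar R))%E.
  congr (_ * _)%E; apply: eq_integral => y _.
  by rewrite /F -EFinD jump_sizeN mulNr sinN; congr EFin; ring.
by rewrite integral01_cst -EFinM mulVf.
Qed.

Lemma integral1B (v : TR -> R) : measurable_fun setT v -> (forall x, `|v x| <= 1) ->
  (\int[mu]_x (1 - v x)%:E = (1 - mean v)%:E)%E.
Proof.
move=> mv v1.
have -> : - mean v = mean (fun x => - v x).
  have := @meanB R (cst 0) v; rewrite mean_cst sub0r => <-//.
    by congr mean; apply/funext => x; rewrite sub0r.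
  by move=> x; rewrite normr0.
rewrite -integral1D//; first exact: measurableT_comp.
by move=> x; rewrite normrN.
Qed.

(** The contribution of the k-th shell to the exponent of the process at f. *)
Definition exponent (k : nat) f : R := 1 - mean (cos \o jump k f).

Let mcj k f : measurable_fun setT f -> measurable_fun setT (cos \o jump k f).
Proof. by move=> mf; exact: (measurableT_comp (@measurable_cosT R) (measurable_jump k mf)). Qed.

Lemma exponent_ge0 k f : measurable_fun setT f -> 0 <= exponent k f.
Proof.
move=> mf; rewrite /exponent subr_ge0 (le_trans (ler_norm _))//.
by apply: mean_le1; [exact: mcj|move=> x; exact: cos_max].
Qed.

Let mcos2 k f : measurable_fun setT f -> measurable_fun setT
  (fun z : TR * TR => (1 - cos (jump_size (shell k z.1) * f z.2))%:E).
Proof.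
move=> mf; apply/measurable_EFinP; apply: measurable_funB => //.
exact: (measurableT_comp (@measurable_cosT R) (mjump2 k mf)).
Qed.

Lemma exponentE k f : measurable_fun setT f ->
  ((exponent k f)%:E = \int[mu]_t \int[mu]_x (1 - cos (jump_size (shell k x) * f t))%:E)%E.
Proof.
move=> mf; rewrite -integral1B; [|exact: mcj|by move=> x; exact: cos_max].
pose G (z : TR * TR) := (1 - cos (jump_size (shell k z.1) * f z.2))%:E.
have G0 z : (0 <= G z)%E by rewrite lee_fin cos_sub1_ge0.
transitivity (\int[mu]_x G (even_digits x, odd_digits x))%E; first by [].
rewrite (integral_digits (mcos2 k mf) G0).
exact: (@fubini_tonelli _ _ _ _ _ mu mu G (mcos2 k mf) G0).
Qed.

(** Summing over the shells turns the mean over the position of a jump into an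
    integral over the line, which [stable_exponent] evaluates at each mark. *)
Lemma series_exponent : exists2 K : R, 0 < K & forall f, measurable_fun setT f ->
  (\sum_(k <oo) (exponent k f)%:E = K%:E * \int[mu]_t (`|f t| `^ p)%:E)%E.
Proof.
have [K K0 HK] := stable_exponent p0 p2.
exists (2^-1 * K); first by rewrite mulr_gt0// invr_gt0.
move=> f mf.
under eq_eseriesr do rewrite exponentE//.
rewrite -integral_nneseries//; last 2 first.
- move=> k; pose G (z : TR * TR) := (1 - cos (jump_size (shell k z.1) * f z.2))%:E.
  have G0 z : (0 <= G z)%E by rewrite lee_fin cos_sub1_ge0.
  exact: (@measurable_fun_fubini_tonelli_G _ _ _ _ _ mu G (mcos2 k mf) G0).
- by move=> k t _; apply: integral_ge0 => x _; rewrite lee_fin cos_sub1_ge0.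
transitivity (\int[mu]_t ((2^-1 * K)%:E * (`|f t| `^ p)%:E))%E.
  apply: eq_integral => t _.
  have mF : measurable_fun setT (fun y : TR => (1 - cos (jump_size y * f t))%:E).
    apply/measurable_EFinP; apply: measurable_funB => //.
    apply: (measurableT_comp (@measurable_cosT R)).
    by apply: measurable_funM => //; exact: measurable_jump_size.
  rewrite (@integral_series_shell (fun y => (1 - cos (jump_size y * f t))%:E))//.
  under eq_integral do rewrite cos_jump_size.
  by rewrite HK EFinM muleA -EFinM.
rewrite ge0_integralZl//.
- apply/measurable_EFinP; exact: (measurableT_comp (measurable_powabs p) mf).
- by rewrite lee_fin mulr_ge0 ?invr_ge0// ltW.
Qed.

Variable N : TR -> nat.
Hypothesis mN : measurable_fun setT N.
Hypothesis Np : forall n, mu (N @^-1` [set n]) = (poisson1 n)%:E.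

(** All the jumps of the k-th shell, in Poisson number. The points and the marks do
    not depend on f, so the sum is linear in f. *)
Definition shell_sum (k : nat) f (x : TR) : TR :=
  indep_sum (fun=> jump k f) (N (even_digits x)) (odd_digits x).

Definition levy_sum (K : nat) f : TR -> R := indep_sum (fun k => shell_sum k f) K.

Lemma levy_sumB K f g x :
  levy_sum K (fun t => f t - g t) x = levy_sum K f x - levy_sum K g x.
Proof.
rewrite /levy_sum /indep_sum -sumrB; apply: eq_bigr => k _.
rewrite /shell_sum /indep_sum -sumrB; apply: eq_bigr => i _.
by rewrite /jump mulrBr.
Qed.

Lemma levy_sumZ K c f x : levy_sum K (fun t => c * f t) x = c * levy_sum K f x.
Proof.
rewrite /levy_sum /indep_sum mulr_sumr; apply: eq_bigr => k _.
rewrite /shell_sum /indep_sum mulr_sumr; apply: eq_bigr => i _.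
by rewrite /jump mulrCA.
Qed.

Lemma shell_sum_trig k f : measurable_fun setT f ->
  [/\ measurable_fun setT (shell_sum k f),
      mean (cos \o shell_sum k f) = expR (- exponent k f)
    & mean (sin \o shell_sum k f) = 0].
Proof.
move=> mf.
have [h1 h2 h3] := mean_trig_compound mN Np (measurable_jump k mf) (mean_sin_jump k mf).
by split => //; rewrite /exponent opprB -h2.
Qed.

Lemma measurable_levy_sum K f : measurable_fun setT f -> measurable_fun setT (levy_sum K f).
Proof. by move=> mf; apply: measurable_indep_sum => k; have [] := shell_sum_trig k mf. Qed.

(** The shells being independent, the characteristic function of the sum of those
    between K and L is the product of theirs. *)
Lemma mean_cos_increment K L f : (K <= L)%N -> measurable_fun setT f ->
  mean (fun x => cos (levy_sum L f x - levy_sum K f x)) =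
  expR (- \sum_(K <= k < L) exponent k f).
Proof.
move=> KL mf.
(* the increment is the sum over all k < L in which the first K terms are
   replaced by 0 *)
pose a k : TR -> R := if (k < K)%N then cst 0 else shell_sum k f.
have ma k : measurable_fun setT (a k).
  by rewrite /a; case: ifP => // _; have [] := shell_sum_trig k mf.
have sa k : mean (sin \o a k) = 0.
  rewrite /a; case: ifP => _; last by have [] := shell_sum_trig k mf.
  by rewrite -[RHS](@mean_cst R 0); congr mean; apply/funext => x /=; rewrite sin0.
have ca k : mean (cos \o a k) = expR (- (if (k < K)%N then 0 else exponent k f)).
  rewrite /a; case: ifP => _; last by have [] := shell_sum_trig k mf.
  by rewrite oppr0 expR0 -[RHS](@mean_cst R 1); congr mean; apply/funext => x /=; rewrite cos0.
have sE : (fun x => cos (levy_sum L f x - levy_sum K f x)) = cos \o indep_sum a L.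
  apply/funext => x /=; congr cos; rewrite /levy_sum /indep_sum.
  rewrite -(big_mkord xpredT (fun k => shell_sum k f (even_digits (iter k odd_digits x)))).
  rewrite -(big_mkord xpredT (fun k => shell_sum k f (even_digits (iter k odd_digits x)))).
  rewrite -(big_mkord xpredT (fun k => a k (even_digits (iter k odd_digits x)))).
  rewrite (@big_cat_nat _ _ _ K 0 L)//= [X in X - _ = _]addrC addrK.
  rewrite [RHS](@big_cat_nat _ _ _ K 0 L)//=.
  have -> : \sum_(0 <= k < K) a k (even_digits (iter k odd_digits x)) = 0.
    by rewrite big_nat_cond big1// => k /andP[/andP[_ kK] _]; rewrite /a kK.
  by rewrite add0r; apply: eq_big_nat => k /andP[Kk _]; rewrite /a ltnNge Kk.
rewrite sE (mean_trig_indep_sum L ma sa).1.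
under eq_bigr do rewrite ca.
rewrite -expR_sum; congr expR; rewrite sumrN; congr (- _).
rewrite -(big_mkord xpredT (fun k => if (k < K)%N then 0 else exponent k f)).
rewrite (big_cat_nat (n := K))//= [X in X + _ = _]big_nat_cond big1 ?add0r.
  by apply: eq_big_nat => k /andP[Kk _]; rewrite ltnNge Kk.
by move=> k /andP[/andP[_ kK] _]; rewrite kK.
Qed.

End levy.

(** * Absolute moments and the Cauchy property *)

Section moments.
Context {R : realType}.
Local Notation leb := (@lebesgue_measure R).
Local Notation TR := (measurableTypeR R).
Local Notation mu := (lebesgue01 R).

Lemma measurable_cos_scaled (X : TR -> R) : measurable_fun setT X ->
  measurable_fun setT (fun z : TR * TR => (1 - cos (z.2 * X z.1))%:E).
Proof.
move=> mX; apply/measurable_EFinP; apply: measurable_funB => //.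
apply: (measurableT_comp (@measurable_cosT R)).
apply: measurable_funM; first exact: measurable_snd.
exact: (measurableT_comp mX measurable_fst).
Qed.

Lemma integral_cos_scaled (X : TR -> R) (l : R) : measurable_fun setT X ->
  (\int[mu]_x (1 - cos (l * X x))%:E = (1 - mean (fun x => cos (l * X x)))%:E)%E.
Proof.
move=> mX; rewrite (@integral1B R (fun x => cos (l * X x)))//.
- apply: (measurableT_comp (@measurable_cosT R)).
  by apply: measurable_funM.
- by move=> x; exact: cos_max.
Qed.

Lemma measurable_mean_cos (X : TR -> R) : measurable_fun setT X ->
  measurable_fun setT (fun l : TR => (1 - mean (fun x => cos (l * X x)))%:E).
Proof.
move=> mX.
rewrite (_ : (fun l : TR => _) = fun l => (\int[mu]_x (1 - cos (l * X x))%:E)%E); last first.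
  by apply/funext => l; rewrite integral_cos_scaled.
have G0 (z : TR * TR) : (0 <= (1 - cos (z.2 * X z.1))%:E)%E by rewrite lee_fin cos_sub1_ge0.
exact: (@measurable_fun_fubini_tonelli_G _ _ _ _ _ mu _ (measurable_cos_scaled mX) G0).
Qed.

(** Average over x the identity of [scale_average] for F = 1 - cos and a = X x. *)
Lemma abs_moment (r : R) : 0 < r -> r < 2 ->
  exists2 C : R, 0 < C & forall X : TR -> R, measurable_fun setT X ->
    (C%:E * \int[mu]_x (`|X x| `^ r)%:E
     = \int[leb]_l ((1 - mean (fun x => cos (l * X x))) * `|l| `^ (- (1 + r)))%:E)%E.
Proof.
move=> r0 r2.
have mF : measurable_fun setT (fun x : TR => 1 - cos x).
  by apply: measurable_funB => //; exact: measurable_cosT.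
have [C C0 HC] := @scale_average R r 2 2 (fun x => 1 - cos x) r0 r2 mF
  (fun x => introT andP (conj (cos_sub1_ge0 x) (cos_sub1_le x)))
  (fun x h => cos_sub1_gt0 (introT andP (conj (lt_le_trans ltr01 (proj1 (elimT andP h)))
    (proj2 (elimT andP h))))).
exists C => // X mX.
have mXr : measurable_fun setT (fun x : TR => (`|X x| `^ r)%:E).
  by apply/measurable_EFinP; exact: (measurableT_comp (measurable_powabs r) mX).
rewrite -ge0_integralZl//; last by rewrite lee_fin ltW.
have mw : measurable_fun setT (fun z : TR * TR => (`|z.2| `^ (- (1 + r)))%:E).
  by apply/measurable_EFinP; exact: (measurableT_comp (measurable_powabs _) measurable_snd).
pose G (z : TR * TR) := ((1 - cos (z.2 * X z.1))%:E * (`|z.2| `^ (- (1 + r)))%:E)%E.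
have mG : measurable_fun setT G by apply: emeasurable_funM => //; exact: measurable_cos_scaled.
have G0 z : (0 <= G z)%E by rewrite mule_ge0// lee_fin ?powR_ge0// cos_sub1_ge0.
transitivity (\int[mu]_x \int[leb]_l G (x, l))%E.
  apply: eq_integral => x _; rewrite -EFinM -HC; apply: eq_integral => l _.
  by rewrite /G/= -EFinM [X x * l]mulrC.
rewrite (@fubini_tonelli _ _ _ _ _ mu leb G mG G0).
apply: eq_integral => l _.
rewrite EFinM -integral_cos_scaled// muleC -ge0_integralZl//.
- by apply: eq_integral => x _; rewrite /G/= muleC.
- apply/measurable_EFinP; apply: measurable_funB => //.
  by apply: (measurableT_comp (@measurable_cosT R)); apply: measurable_funM.
Qed.

Variable (p : R).
Hypothesis p0 : 0 < p.
Hypothesis p2 : p < 2.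
Variable N : TR -> nat.
Hypothesis mN : measurable_fun setT N.
Hypothesis Np : forall n, mu (N @^-1` [set n]) = (poisson1 n)%:E.

Implicit Types f g : TR -> R.

Definition in_Lp f : Prop := measurable_fun setT f /\ (\int[mu]_t (`|f t| `^ p)%:E < +oo)%E.

Lemma exponentZ k (l : R) f :
  exponent p k (fun t => l * f t) = 1 - mean (fun x => cos (l * jump p k f x)).
Proof.
congr (1 - mean _); apply/funext => x /=; rewrite /jump; congr cos; ring.
Qed.

Lemma measurable_exponent k f : measurable_fun setT f ->
  measurable_fun setT (fun l : TR => exponent p k (fun t => l * f t)).
Proof.
move=> mf; under eq_fun do rewrite exponentZ.
apply/measurable_EFinP; apply: measurable_mean_cos.
exact: measurable_jump.
Qed.

Lemma integral_powZ (l : R) f : in_Lp f ->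
  (\int[mu]_t (`|l * f t| `^ p)%:E = (`|l| `^ p)%:E * \int[mu]_t (`|f t| `^ p)%:E)%E.
Proof.
move=> [mf _]; rewrite -ge0_integralZl//.
- by apply: eq_integral => t _; rewrite normrM powRM// EFinM.
- by apply/measurable_EFinP; exact: (measurableT_comp (measurable_powabs _) mf).
Qed.

Lemma exponent_cvg : exists2 K : R, 0 < K & forall f (l : R), in_Lp f ->
  (fun n => \sum_(0 <= k < n) exponent p k (fun t => l * f t)) @ \oo -->
    (K * `|l| `^ p * fine (\int[mu]_t (`|f t| `^ p)%:E)).
Proof.
have [K K0 HK] := series_exponent p0 p2.
exists K => // f l Lf.
have [mf fin] := Lf.
have mlf : measurable_fun setT (fun t => l * f t) by exact: measurable_funM.
have fE : (\int[mu]_t (`|f t| `^ p)%:E \is a fin_num)%E.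
  by rewrite ge0_fin_numE// integral_ge0// => t _; rewrite lee_fin powR_ge0.
have H : (\sum_(k <oo) (exponent p k (fun t => (l * f t)%R))%:E =
    (K * `|l| `^ p * fine (\int[mu]_t (`|f t| `^ p)%:E))%:E)%E.
  by rewrite (HK _ mlf) integral_powZ// !EFinM fineK// muleA.
have c : (fun n => \sum_(0 <= k < n) (exponent p k (fun t => l * f t))%:E)%E @ \oo -->
    (K * `|l| `^ p * fine (\int[mu]_t (`|f t| `^ p)%:E))%:E.
  rewrite -H; apply: is_cvg_nneseries => n _ _.
  by rewrite lee_fin exponent_ge0.
move/fine_cvgP : c => [_]; apply: cvg_trans; apply: near_eq_cvg; apply: nearW => n /=.
by rewrite sumEFin.
Qed.

(** By [abs_moment], the r-th moment of an increment from K to L is an integral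
    over l of 1 - exp(-(sum of the exponents from K to L)) against a weight. It is
    at most the one with all exponents from K on, which tends to 0 by dominated
    convergence: the integrand D that uses all exponents from 0 on is integrable
    because these add up to a multiple of |l|^p and r < p. *)
Lemma levy_sum_cauchy (r : R) f : 0 < r -> r < p -> in_Lp f ->
  forall e : R, 0 < e -> exists K0 : nat, forall K L, (K0 <= K)%N -> (K <= L)%N ->
    (\int[mu]_x (`|levy_sum p N L f x - levy_sum p N K f x| `^ r)%:E <= e%:E)%E.
Proof.
move=> r0 rp Lf e e0; have [mf fin] := Lf.
have [C C0 HC] := abs_moment r0 (lt_trans rp p2).
have [Kc Kc0 HK] := exponent_cvg.
pose A := fine (\int[mu]_t (`|f t| `^ p)%:E).
have A0 : 0 <= A by apply: fine_ge0; apply: integral_ge0 => t _; rewrite lee_fin powR_ge0.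
pose t (l : R) := Kc * `|l| `^ p * A.
have t0 l : 0 <= t l by rewrite !mulr_ge0 ?powR_ge0// ltW.
pose s n (l : R) := \sum_(0 <= k < n) exponent p k (fun x => l * f x).
have mlf l : measurable_fun setT (fun t => l * f t) by exact: measurable_funM.
have snd l : nondecreasing_seq (s ^~ l).
  apply/nondecreasing_seqP => n; rewrite /s big_nat_recr//= lerDl.
  exact: exponent_ge0.
have scv l : s ^~ l @ \oo --> t l by exact: HK.
have st n l : s n l <= t l.
  rewrite -(cvg_lim _ (scv l))//; apply: nondecreasing_cvgn_le => //.
  by apply/cvg_ex; exists (t l); exact: scv.
have s0 n l : 0 <= s n l by apply: sumr_ge0 => k _; exact: exponent_ge0.
have ms n : measurable_fun setT (s n : TR -> R).
  by rewrite /s; apply: measurable_sum => k; exact: measurable_exponent.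
have mt : measurable_fun setT (t : TR -> R).
  apply: measurable_funM => //; apply: measurable_funM => //.
  exact: measurable_powabs.
pose g n (l : TR) := ((1 - expR (- (t l - s n l))) * `|l| `^ (- (1 + r)))%:E.
have mexp (h : TR -> R) : measurable_fun setT h ->
  measurable_fun setT (fun l : TR => (1 - expR (- h l)) * `|l| `^ (- (1 + r))).
  move=> mh; apply: measurable_funM; last exact: measurable_powabs.
  apply: measurable_funB => //; apply: (measurableT_comp (@measurable_expR R)).
  exact: measurableT_comp.
have mg n : measurable_fun setT (g n).
  by apply/measurable_EFinP; apply: mexp; exact: measurable_funB.
have h0 (y : R) : 0 <= y -> 0 <= 1 - expR (- y).
  by move=> y0; rewrite subr_ge0 expR_le1 oppr_le0.
pose D (l : TR) := ((1 - expR (- t l)) * `|l| `^ (- (1 + r)))%:E.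
have mD : measurable_fun setT D by apply/measurable_EFinP; exact: mexp.
have gD n l : (`|g n l| <= D l)%E.
  rewrite /g /D gee0_abs ?lee_fin; last first.
    by rewrite mulr_ge0 ?powR_ge0// h0// subr_ge0.
  by rewrite ler_wpM2r ?powR_ge0// lerD2l lerN2 ler_expR lerN2 gerBl.
have iD : leb.-integrable setT D.
  apply/integrableP; split => //.
  under eq_integral do rewrite gee0_abs ?lee_fin ?mulr_ge0 ?powR_ge0 ?h0//.
  apply: (@integral_weight_lty R r p (Num.max 1 (Kc * A))) => //.
    apply: measurable_funB => //; apply: (measurableT_comp (@measurable_expR R)).
    exact: measurableT_comp.
  move=> l; rewrite h0//=.
  have m0 : 0 <= Num.max 1 (Kc * A) by rewrite le_max ler01.
  rewrite minr_pMr// mulr1 le_min; apply/andP; split.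
    by rewrite le_max gerBl expR_ge0.
  apply: (@le_trans _ _ (t l)).
    by have := expR_ge1Dx (- t l); lra.
  rewrite /t mulrAC ler_wpM2r ?powR_ge0// le_max lexx orbT//.
have P1 : {ae leb, forall l, setT l -> g ^~ l @ \oo --> 0%E}.
  apply: nearW => l _; apply/fine_cvgP; split; first by apply: nearW.
  rewrite /= (_ : 0 = (1 - expR (- (t l - t l))) * `|l| `^ (- (1 + r))); last first.
    by rewrite subrr oppr0 expR0 subrr mul0r.
  apply: cvgM; last exact: cvg_cst.
  apply: cvgB; first exact: cvg_cst.
  apply: (continuous_cvg _ (@continuous_expR R _)).
  by apply: cvgN; apply: cvgB; [exact: cvg_cst|exact: scv].
have P2 : {ae leb, forall l n, setT l -> (`|g n l| <= D l)%E}.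
  by apply: nearW => l n _; exact: gD.
have [_ _] := @dominated_convergence _ _ _ leb setT measurableT g (cst 0%E) D mg
  (measurable_cst _) P1 iD P2.
rewrite integral0 => /fine_cvgP[Hfin Hcv].
have Ce0 : 0 < C * e by rewrite mulr_gt0.
have [K0 _ HK0] : \forall n \near \oo, (\int[leb]_l g n l <= (C * e)%:E)%E.
  move: Hcv => /cvgr_lt /(_ _ Ce0) Hcv.
  apply: filterS2 Hfin Hcv => n /= fn h; rewrite -[X in (X <= _)%E](fineK fn) lee_fin.
  exact: ltW.
exists K0 => K L K0K KL.
have mS n : measurable_fun setT (levy_sum p N n f) by exact: measurable_levy_sum.
rewrite -(@lee_pmul2l _ C%:E)// ?lte_fin// HC; last exact: measurable_funB.
rewrite -EFinM; apply: le_trans (HK0 K K0K).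
have mm (l : R) : mean (fun x => cos (l * (levy_sum p N L f x - levy_sum p N K f x))) =
    expR (- (s L l - s K l)).
  transitivity (mean (fun x => cos (levy_sum p N L (fun y => l * f y) x - levy_sum p N K
    (fun y => l * f y) x))).
    by congr mean; apply/funext => x; rewrite !levy_sumZ mulrBr.
  rewrite (mean_cos_increment _ mN Np KL (mlf l)); congr (expR (- _)).
  by rewrite /s (@big_cat_nat _ _ _ K 0 L)//= addrC addrK.
apply: ge0_le_integral => //.
- move=> l _; rewrite mm lee_fin mulr_ge0 ?powR_ge0// h0// subr_ge0.
  exact: snd.
- apply/measurable_EFinP; under eq_fun do rewrite mm.
  by apply: mexp; exact: measurable_funB.
- move=> l _; rewrite mm lee_fin ler_wpM2r ?powR_ge0// lerD2l lerN2 ler_expR lerN2.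
  by rewrite lerD2r.
Qed.

End moments.

(** * Completeness for moments of order at most one *)

Section completeness.
Context {R : realType}.
Local Notation TR := (measurableTypeR R).
Local Notation mu := (lebesgue01 R).

Lemma cvg_powR (r : R) (u : nat -> R) (l : R) : 0 < r -> (forall n, 0 <= u n) ->
  u @ \oo --> l -> (fun n => u n `^ r) @ \oo --> l `^ r.
Proof.
move=> r0 u0 ul.
have l0 : 0 <= l.
  rewrite -(cvg_lim _ ul)//; apply: limr_ge; first by apply/cvg_ex; exists l.
  by apply: nearW.
have [l00|ln0] := eqVneq l 0.
  rewrite l00 powR0 ?gt_eqF//; apply/cvgrPdist_lt => e e0.
  have er : 0 < e `^ r^-1 by rewrite powR_gt0.
  move: ul; rewrite l00 => /cvgrPdist_lt /(_ _ er); apply: filterS => n.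
  rewrite !sub0r !normrN ger0_norm// => h; rewrite ger0_norm ?powR_ge0//.
  have -> : e = (e `^ r^-1) `^ r by rewrite -powRrM mulVf ?gt_eqF// powRr1// ltW.
  by rewrite gt0_ltr_powR ?nnegrE ?powR_ge0.
have lp : 0 < l by rewrite lt_neqAle eq_sym ln0.
have cl : {for l, continuous (fun x : R => x `^ r)}.
  apply/differentiable_continuous/derivable1_diffP.
  by case: (is_derive1_powR r lp).
exact: (continuous_cvg _ cl ul).
Qed.

(** Along a subsequence the distances D i of consecutive terms have a sum T of
    finite integral, so T is finite almost everywhere. There, as r <= 1 and
    D i <= T, the increments (D i)^(1/r) are at most T^(1/r - 1) D i, so the
    subsequence converges; Fatou's lemma transfers the Cauchy bound to the
    limit. *)
Lemma Lr_complete (r : R) (X : nat -> TR -> R) : 0 < r -> r <= 1 ->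
  (forall n, measurable_fun setT (X n)) ->
  (forall e : R, 0 < e -> exists K0 : nat, forall K L, (K0 <= K)%N -> (K <= L)%N ->
    (\int[mu]_x (`|X L x - X K x| `^ r)%:E <= e%:E)%E) ->
  exists Y : TR -> R, measurable_fun setT Y /\
  forall e : R, 0 < e -> exists K0 : nat, forall K, (K0 <= K)%N ->
    (\int[mu]_x (`|Y x - X K x| `^ r)%:E <= e%:E)%E.
Proof.
move=> r0 r1 mX HX.
have mXX m n : measurable_fun setT (fun x : TR => `|X m x - X n x| `^ r).
  by apply: (measurableT_comp (measurable_powabs r)); exact: measurable_funB.
have hpos (i : nat) : 0 < 2^-1 ^+ i :> R by rewrite exprn_gt0 ?invr_gt0.
have [k Hk] := choice (fun i => HX _ (hpos i)).
pose n i := (\sum_(j < i.+1) (k j).+1)%N.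
have nS i : (n i < n i.+1)%N by rewrite /n [X in (_ < X)%N]big_ord_recr/= -addSnnS leq_addr.
have nk i : (k i <= n i)%N.
  by rewrite /n big_ord_recr/= (leq_trans (leqnSn _))// leq_addl.
have ni i : (i <= n i)%N by elim: i => // i IH; exact: leq_ltn_trans IH (nS i).
pose D i x := `|X (n i.+1) x - X (n i) x| `^ r.
have D0 i x : 0 <= D i x by exact: powR_ge0.
have mD i : measurable_fun setT (fun x : TR => (D i x)%:E).
  by apply/measurable_EFinP; exact: mXX.
pose T x := (\sum_(i <oo) (D i x)%:E)%E.
have mT : measurable_fun setT T.
  apply: ge0_emeasurable_sum => [i x _ _|i _]; first by rewrite lee_fin.
  exact: mD.
have T0 x : (0 <= T x)%E by apply: nneseries_ge0 => i _ _; rewrite lee_fin.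
have IT : (\int[mu]_x T x < +oo)%E.
  rewrite integral_nneseries//; last by move=> i x _; rewrite lee_fin.
  apply: (@le_lt_trans _ _ (\sum_(i <oo) (2^-1 ^+ i)%:E)%E).
    apply: lee_nneseries => [i _ _|i _]; first by apply: integral_ge0 => x _; rewrite lee_fin.
    by apply: (Hk i); [exact: nk|exact: ltnW].
  rewrite (@eseries_EFin R _ (1 * (1 - 2^-1)^-1)) ?ltry//.
  rewrite (_ : GRing.exp 2^-1 = geometric 1 2^-1 :> (nat -> R)); last first.
    by apply/funext => i; rewrite /geometric/= mul1r.
  by apply: cvg_geometric_series; rewrite ger0_norm ?invr_ge0// invf_lt1// ltr1n.
have iT : mu.-integrable setT T.
  by apply/integrableP; split => //; under eq_integral do rewrite gee0_abs//.
pose G := [set x | T x \is a fin_num].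
have mG : measurable G.
  by rewrite -[G]setTI; exact: emeasurable_fin_num.
have aeG : {ae mu, forall x, setT x -> \1_G x = 1 :> R}.
  apply: filterS (integrable_ae measurableT iT) => x h _.
  by rewrite indicE mem_set//; exact: h.
(* cut off outside G, the subsequence converges everywhere *)
pose X' m x := X m x * \1_G x.
have mind : measurable_fun setT (\1_G : TR -> R) by exact: measurable_indic.
have mX' m : measurable_fun setT (X' m) by exact: measurable_funM.
have cX' x : cvgn (fun i => X' (n i) x).
  rewrite /X' indicE; case: (boolP (x \in G)) => xG; last first.
    under eq_fun do rewrite mulr0.
    exact: is_cvg_cst.
  under eq_fun do rewrite mulr1.
  move: xG; rewrite inE /G/= => Tfin.
  pose t := fine (T x).
  have Dt i : D i x <= t.
    rewrite -lee_fin fineK//.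
    apply: (@le_trans _ _ (\sum_(0 <= j < i.+1) (D j x)%:E)%E).
      by rewrite big_nat_recr//= leeDr// sume_ge0// => j _; rewrite lee_fin.
    by apply: nneseries_lim_ge => j _ _; rewrite lee_fin.
  have sD : cvgn (series (fun i => D i x)).
    apply: nondecreasing_is_cvgn.
      apply/nondecreasing_seqP => m; rewrite !seriesEnat/= big_nat_recr//= lerDl.
      exact: D0.
    exists t => _ [m _ <-]; rewrite -lee_fin fineK// seriesEnat/= -sumEFin.
    by apply: nneseries_lim_ge => j _ _; rewrite lee_fin.
  have t0 : 0 <= t by rewrite fine_ge0.
  pose c := t `^ (r^-1 - 1).
  have sDc : cvgn (series (fun i => c * D i x)).
    rewrite (_ : series _ = fun m => c * series (fun i => D i x) m); last first.
      by apply/funext => m; rewrite !seriesEnat/= mulr_sumr.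
    by apply: is_cvgM => //; exact: is_cvg_cst.
  have sX : cvgn (series (telescope (fun i => X (n i) x))).
    apply: normed_cvg; apply: series_le_cvg sDc => i //=.
    - by rewrite mulr_ge0 ?powR_ge0.
    - have -> : `|X (n i.+1) x - X (n i) x| = D i x * D i x `^ (r^-1 - 1).
        rewrite mulr_powRB1 ?invr_gt0// /D -powRrM divff ?gt_eqF// powRr1//.
      rewrite mulrC ler_wpM2r// ge0_ler_powR ?nnegrE//.
      by rewrite subr_ge0 invf_ge1.
  have -> : (fun i => X (n i) x) = (fun i => series (telescope (fun i => X (n i) x)) i +
    X (n 0%N) x).
    by apply/funext => i; rewrite telescopeK/= subrK.
  by apply: is_cvgD => //; exact: is_cvg_cst.
pose Y x := limn (fun i => X' (n i) x).
have YE x : (fun i => X' (n i) x) @ \oo --> Y x by exact: cX'.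
have mY : measurable_fun setT Y.
  by apply: (@measurable_fun_cvg _ _ _ _ (fun i => X' (n i))).
exists Y; split => // e e0; have [K0 HK0] := HX _ e0.
exists K0 => K K0K.
have mYK m : measurable_fun setT (fun x : TR => (`|X' m x - X' K x| `^ r)%:E).
  by apply/measurable_EFinP; apply: (measurableT_comp (measurable_powabs r));
    exact: measurable_funB.
have -> : (\int[mu]_x (`|Y x - X K x| `^ r)%:E = \int[mu]_x (`|Y x - X' K x| `^ r)%:E)%E.
  apply: ge0_ae_eq_integral => //.
  - by apply/measurable_EFinP; apply: (measurableT_comp (measurable_powabs r));
    exact: measurable_funB.
  - by apply/measurable_EFinP; apply: (measurableT_comp (measurable_powabs r));
    exact: measurable_funB.
  - by apply: filterS aeG => x /(_ I) Gx _; rewrite /X' Gx mulr1.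
have -> : (\int[mu]_x (`|Y x - X' K x| `^ r)%:E = \int[mu]_x limn_einf (fun i => (`|X' (n
  (i + K)%N) x - X' K x| `^ r)%:E))%E.
  apply: eq_integral => x _.
  have c : (fun i => `|X' (n (i + K)%N) x - X' K x| `^ r) @ \oo --> `|Y x - X' K x| `^ r.
    apply: cvg_powR => //; apply: cvg_norm.
    apply: cvgB; last exact: cvg_cst.
    by have := YE x; rewrite -(cvg_shiftn K).
  have c' : (fun i => (`|X' (n (i + K)%N) x - X' K x| `^ r)%:E) @ \oo --> (`|Y x - X' K
    x| `^ r)%:E.
    by apply/fine_cvgP; split => //; apply: nearW.
  by rewrite (cvg_limn_einf_sup c').
apply: le_trans (fatou _ _ _ _) _ => //.
rewrite limn_einf_lim; apply: lime_le; first exact: is_cvg_einfs.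
apply: nearW => i.
apply: (@le_trans _ _ (\int[mu]_x (`|X' (n (i + K)%N) x - X' K x| `^ r)%:E)%E).
  by apply: ereal_inf_lbound; exists i => //=.
apply: le_trans (HK0 K (n (i + K)%N) K0K _); last first.
  by rewrite (leq_trans _ (ni _))// leq_addl.
apply: ge0_le_integral => //.
- by apply/measurable_EFinP; exact: mXX.
- move=> x _; rewrite lee_fin /X' -mulrBl normrM.
  apply: ge0_ler_powR; rewrite ?nnegrE ?mulr_ge0//; first exact: ltW.
  by rewrite ler_piMr// indicE; case: (x \in G); rewrite ?normr1 ?normr0.
Qed.
End completeness.

(** * The stable process *)

Section stable_process.
Context {R : realType}.
Local Notation leb := (@lebesgue_measure R).
Local Notation TR := (measurableTypeR R).
Local Notation mu := (lebesgue01 R).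

(** Cosines of variables that are close for the r-th moment have close means. *)
Lemma cos_dist_powR (r x y : R) : 0 < r -> r <= 1 -> `|cos x - cos y| <= 2 * `|x - y| `^ r.
Proof.
move=> r0 r1; have [xy|xy] := leP `|x - y| 1.
  have [/eqP|xy0] := eqVneq `|x - y| 0.
    rewrite normr_eq0 subr_eq0 => /eqP ->.
    by rewrite !subrr normr0 powR0 ?gt_eqF// mulr0.
  apply: (le_trans (cos_dist _ _)); apply: (@le_trans _ _ (`|x - y| `^ r)).
    by apply: ger1_powR => //; rewrite xy andbT lt_neqAle eq_sym xy0 normr_ge0.
  by rewrite ler_peMl ?powR_ge0// ler1n.
apply: (@le_trans _ _ 2).
  by rewrite (le_trans (ler_normB _ _))// (_ : 2 = 1 + 1)// lerD ?cos_max.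
rewrite ler_peMr//; have h1 : (1 : R) `^ r = 1 by rewrite powR1.
rewrite -[leLHS]h1; apply: ge0_ler_powR; rewrite ?nnegrE//; exact: ltW.
Qed.

Variable (p : R).
Hypothesis p0 : 0 < p.

Implicit Types f g : TR -> R.

Lemma in_Lp0 : in_Lp p (cst 0).
Proof.
split; first exact: measurable_cst.
under eq_integral do rewrite /= normr0 powR0 ?gt_eqF//.
by rewrite integral0.
Qed.

(** From |a - b| <= 2 max(|a|, |b|), valid for all p > 0. *)
Lemma in_LpB f g : in_Lp p f -> in_Lp p g -> in_Lp p (fun x => f x - g x).
Proof.
move=> [mf Lf] [mg Lg]; split; first exact: measurable_funB.
have mfp : measurable_fun setT (fun x : TR => (`|f x| `^ p)%:E).
  by apply/measurable_EFinP; exact: (measurableT_comp (measurable_powabs p) mf).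
have mgp : measurable_fun setT (fun x : TR => (`|g x| `^ p)%:E).
  by apply/measurable_EFinP; exact: (measurableT_comp (measurable_powabs p) mg).
apply: (@le_lt_trans _ _ (\int[mu]_x ((2 `^ p)%:E * ((`|f x| `^ p)%:E + (`|g x| `^ p)%:E)))%E).
  apply: ge0_le_integral => //.
  - apply/measurable_EFinP; apply: (measurableT_comp (measurable_powabs p)).
    exact: measurable_funB.
  - by apply: measurable_funeM; exact: emeasurable_funD.
  - move=> x _; rewrite -EFinD -EFinM lee_fin.
    apply: (@le_trans _ _ ((2 * Num.max `|f x| `|g x|) `^ p)).
      apply: ge0_ler_powR; rewrite ?nnegrE ?mulr_ge0//.
      - exact: ltW.
      rewrite (le_trans (ler_normB _ _))// mulr2n mulrDl mul1r.
      by rewrite lerD// le_max lexx ?orbT.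
    rewrite powRM ?le_max ?normr_ge0// ler_wpM2l ?powR_ge0//.
    by case: (leP `|f x| `|g x|) => _; rewrite ?lerDr ?lerDl powR_ge0.
rewrite ge0_integralZl//; last 2 first.
- exact: emeasurable_funD.
- by move=> x _; rewrite adde_ge0// lee_fin powR_ge0.
rewrite ge0_integralD//.
by rewrite lte_mul_pinfty ?lee_fin ?powR_ge0// lte_add_pinfty.
Qed.

Hypothesis p2 : p < 2.

(** For each f the partial sums of the shells converge in the moment of order p/2,
    and their limits keep the limit of the characteristic functions. *)
Lemma stable_process : exists (Th : (TR -> R) -> TR -> R), exists2 K : R, 0 < K &
  (forall f, in_Lp p f -> measurable_fun setT (Th f)) /\
  (forall f g l, in_Lp p f -> in_Lp p g ->
    mean (fun x => cos (l * (Th f x - Th g x))) =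
    expR (- (K * `|l| `^ p * fine (\int[mu]_t (`|f t - g t| `^ p)%:E)))).
Proof.
have [N [mN Np]] := @poisson_variable R.
have [K K0 HK] := exponent_cvg p0 p2.
pose r := p / 2.
have r0 : 0 < r by rewrite divr_gt0.
have rp : r < p by rewrite /r ltr_pdivrMr// ltr_pMr// ltr1n.
have r1 : r <= 1 by rewrite /r ler_pdivrMr// mul1r ltW.
have exX f : exists X : TR -> R, in_Lp p f -> measurable_fun setT X /\
    forall e : R, 0 < e -> exists K0 : nat, forall K, (K0 <= K)%N ->
    (\int[mu]_x (`|X x - levy_sum p N K f x| `^ r)%:E <= e%:E)%E.
  have [Lf|nLf] := pselect (in_Lp p f); last by exists (cst 0).
  have mS n : measurable_fun setT (levy_sum p N n f).
    by case: Lf => mf _; exact: measurable_levy_sum.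
  have [Y HY] := @Lr_complete R r (fun n => levy_sum p N n f) r0 r1 mS
    (levy_sum_cauchy p0 p2 mN Np r0 rp Lf).
  by exists Y.
have [Th HTh] := choice exX.
exists Th, K => //; split; first by move=> f /HTh[].
move=> f g l Lf Lg.
have [mf HF] := HTh _ Lf; have [mg HG] := HTh _ Lg.
have [mf' _] := Lf; have [mg' _] := Lg.
have Lfg := in_LpB Lf Lg; have [mfg _] := Lfg.
have mSf n : measurable_fun setT (levy_sum p N n f) by exact: measurable_levy_sum.
have mSg n : measurable_fun setT (levy_sum p N n g) by exact: measurable_levy_sum.
pose u n := mean (fun x => cos (l * (levy_sum p N n f x - levy_sum p N n g x))).
have uE n : u n = expR (- \sum_(0 <= k < n) exponent p k (fun t => l * (f t - g t))).
  have mlfg : measurable_fun setT (fun t => l * (f t - g t)) by exact: measurable_funM.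
  rewrite -(mean_cos_increment _ mN Np (leq0n n) mlfg) /u.
  congr mean; apply/funext => x; congr cos.
  rewrite [X in _ = _ - X](_ : _ = 0); first by rewrite subr0 levy_sumZ levy_sumB.
  by rewrite /levy_sum /indep_sum big_ord0.
have c1 : u @ \oo --> expR (- (K * `|l| `^ p * fine (\int[mu]_t (`|f t - g t| `^ p)%:E))).
  rewrite (_ : u = fun n => expR (- \sum_(0 <= k < n) exponent p k (fun t => l * (f t - g
    t)))); last first.
    by apply/funext => n; exact: uE.
  apply: (continuous_cvg _ (@continuous_expR R _)); apply: cvgN.
  exact: HK.
have c2 : u @ \oo --> mean (fun x => cos (l * (Th f x - Th g x))).
  apply/cvgrPdist_le => e e0.
  pose d := e / (4 * (`|l| `^ r + 1)).
  have lr0 : 0 < `|l| `^ r + 1 by rewrite ltr_wpDl ?powR_ge0.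
  have d0 : 0 < d by rewrite divr_gt0// mulr_gt0.
  have [Kf HKf] := HF _ d0; have [Kg HKg] := HG _ d0.
  exists (maxn Kf Kg) => // n /=; rewrite geq_max => /andP[nf ng].
  have mc (X Y : TR -> R) : measurable_fun setT X -> measurable_fun setT Y ->
      measurable_fun setT (fun x : TR => cos (l * (X x - Y x))).
    move=> mX mY; apply: (measurableT_comp (@measurable_cosT R)).
    by apply: measurable_funM => //; exact: measurable_funB.
  have cb (X Y : TR -> R) x : `|cos (l * (X x - Y x))| <= 1 by exact: cos_max.
  rewrite /u -meanB//; [|exact: mc|exact: mc].
  have mdiff : measurable_fun setT (fun x : TR => cos (l * (Th f x - Th g x)) -
      cos (l * (levy_sum p N n f x - levy_sum p N n g x))).
    by apply: measurable_funB; exact: mc.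
  have mpow (X Y : TR -> R) : measurable_fun setT X -> measurable_fun setT Y ->
      measurable_fun setT (fun x : TR => (`|X x - Y x| `^ r)%:E).
    move=> mX mY; apply/measurable_EFinP.
    by apply: (measurableT_comp (measurable_powabs r)); exact: measurable_funB.
  have idiff : mu.-integrable setT (EFin \o (fun x : TR => cos (l * (Th f x - Th g x)) -
      cos (l * (levy_sum p N n f x - levy_sum p N n g x)))).
    apply: (integrableB measurableT (f := EFin \o _) (g := EFin \o _)).
      by apply: integrable_le1; [exact: mc|exact: cb].
    by apply: integrable_le1; [exact: mc|exact: cb].
  rewrite -lee_fin (le_trans (_ : _ <= \int[mu]_x `|cos (l * (Th f x - Th g x)) -
      cos (l * (levy_sum p N n f x - levy_sum p N n g x))|%:E)%E)//.
    rewrite -[leRHS]fineK; last first.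
      by apply: integrable_fin_num => //; exact: (integrable_norm idiff).
    by rewrite lee_fin; exact: le_normr_Rintegral.
  apply: (@le_trans _ _ (\int[mu]_x ((2 * `|l| `^ r)%:E *
    ((`|Th f x - levy_sum p N n f x| `^ r)%:E + (`|Th g x - levy_sum p N n g x| `^ r)%:E)))%E).
    apply: ge0_le_integral => //.
    - by apply/measurable_EFinP; exact: measurableT_comp.
    - by apply: measurable_funeM; apply: emeasurable_funD; exact: mpow.
    - move=> x _; rewrite -EFinD -EFinM lee_fin.
      set a := Th f x; set b := Th g x; set a' := levy_sum p N n f x;
        set b' := levy_sum p N n g x.
      have -> : cos (l * (a - b)) - cos (l * (a' - b')) =
        (cos (l * (a - b)) - cos (l * (a' - b))) + (cos (l * (a' - b)) - cos (l * (a' -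
          b'))) by ring.
      apply: (le_trans (ler_normD _ _)); rewrite [leRHS]mulrDr; apply: lerD.
        apply: (le_trans (cos_dist_powR _ _ r0 r1)).
        by rewrite (_ : _ - _ = l * (a - a')) ?normrM ?powRM ?mulrA//; ring.
      apply: (le_trans (cos_dist_powR _ _ r0 r1)).
      by rewrite (_ : _ - _ = l * (b' - b)) ?normrM ?powRM ?mulrA ?[`|b' - b|]distrC//; ring.
  rewrite ge0_integralZl//; last 2 first.
  - by apply: emeasurable_funD; exact: mpow.
  - by move=> x _; rewrite adde_ge0// lee_fin powR_ge0.
  rewrite ge0_integralD//; [|exact: mpow|exact: mpow].
  apply: (@le_trans _ _ ((2 * `|l| `^ r)%:E * (d%:E + d%:E))%E).
    by rewrite lee_wpmul2l ?lee_fin ?mulr_ge0 ?powR_ge0//; apply: leeD; [exact: HKf|exact: HKg].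
  rewrite -EFinD -EFinM lee_fin /d.
  have -> : 2 * `|l| `^ r * (e / (4 * (`|l| `^ r + 1)) + e / (4 * (`|l| `^ r + 1))) =
     e * (`|l| `^ r / (`|l| `^ r + 1)) by field; rewrite gt_eqF.
  apply: ler_piMr; first exact: ltW.
  by rewrite ler_pdivrMr// mul1r lerDl.
exact: (cvg_unique _ c2 c1).
Qed.

(** Insert the characteristic function into [abs_moment] and use [scale_average]
    for F = 1 - exp(-|x|^p) at the scale a = (K A)^(1/p), where A is the integral
    of |f - g|^p. *)
Lemma stable_moments (q : R) : 0 < q -> q < p ->
  exists (Th : (TR -> R) -> TR -> R), exists2 C : R, 0 < C &
  (forall f, in_Lp p f -> measurable_fun setT (Th f)) /\
  (forall f g, in_Lp p f -> in_Lp p g ->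
    (\int[mu]_x (`|Th f x - Th g x| `^ q)%:E =
     (C * fine (\int[mu]_t (`|f t - g t| `^ p)%:E) `^ (q / p))%:E)%E).
Proof.
move=> q0 qp; have [Th [K K0 [mTh HTh]]] := stable_process.
have [C1 C10 HC1] := @abs_moment R q q0 (lt_trans qp p2).
pose F (x : TR) := 1 - expR (- (`|x| `^ p)).
have mF : measurable_fun setT F.
  apply: measurable_funB => //; apply: (measurableT_comp (@measurable_expR R)).
  by apply: measurableT_comp => //; exact: measurable_powabs.
have F1 x : 0 <= F x <= 1 * Num.min 1 (`|x| `^ p).
  rewrite mul1r le_min /F subr_ge0 expR_le1 oppr_le0 powR_ge0 gerBl expR_ge0/=.
  by have := expR_ge1Dx (- (`|x| `^ p)); lra.
have F12 x : 1 <= x <= 2 -> 0 < F x.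
  move=> /andP[x1 _]; rewrite /F subr_gt0 expR_lt1 oppr_lt0 powR_gt0// normr_gt0.
  by rewrite gt_eqF// (lt_le_trans _ x1).
have [C2 C20 HC2] := scale_average q0 qp mF F1 F12.
exists Th, (C1^-1 * C2 * K `^ (q / p)).
  by rewrite !mulr_gt0 ?invr_gt0// powR_gt0.
split => // f g Lf Lg; have mf := mTh _ Lf; have mg := mTh _ Lg.
set A := fine _.
have A0 : 0 <= A by apply: fine_ge0; apply: integral_ge0 => t _; rewrite lee_fin powR_ge0.
have mfg : measurable_fun setT (fun x => Th f x - Th g x) by exact: measurable_funB.
have := HC1 _ mfg.
have -> : (\int[leb]_l ((1 - mean (fun x => cos (l * (Th f x - Th g x)))) * `|l| `^ (- (1
  + q)))%:E
   = (C2 * (K * A) `^ (q / p))%:E)%E.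
  have -> : (K * A) `^ (q / p) = `|(K * A) `^ p^-1| `^ q.
    by rewrite ger0_norm ?powR_ge0// -powRrM [q / p]mulrC.
  rewrite -HC2; apply: eq_integral => l _; rewrite HTh//; congr (_ * _)%:E.
  have KA : ((K * A) `^ p^-1) `^ p = K * A.
    by rewrite -powRrM mulVf ?gt_eqF// powRr1// mulr_ge0// ltW.
  rewrite /F normrM ger0_norm ?powR_ge0// [X in _ = 1 - expR (- X)]powRM ?powR_ge0// KA.
  by congr (1 - expR (- _)); rewrite -/A; ring.
move=> H.
have := congr1 (fun z => (C1^-1)%:E * z)%E H.
rewrite muleA -EFinM mulVf ?gt_eqF// mul1e => ->.
rewrite powRM//; last exact: ltW.
by rewrite -EFinM; congr EFin; ring.
Qed.

End stable_process.

(** * Embedding a power of the distance on the line *)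

Section kernel.
Context {R : realType}.
Local Notation leb := (@lebesgue_measure R).
Local Notation TR := (measurableTypeR R).

(** A Lipschitz function of compact support that is the identity on [0, 2]. *)
Definition tent (x : R) : R := Num.max 0 (2 - `|x - 2|).

Lemma tent_id x : 0 <= x <= 2 -> tent x = x.
Proof.
move=> /andP[x0 x2]; rewrite /tent ler0_norm ?subr_le0// opprB opprB addrC subrK.
exact: max_r.
Qed.

Lemma tent_out x : ~~ (0 <= x <= 4) -> tent x = 0.
Proof.
move=> h; rewrite /tent; apply: max_l; rewrite subr_le0; apply/ltW.
by move: h; rewrite negb_and -!ltNge => /orP[h|h]; rewrite lter_normr; apply/orP;
  [right|left]; lra.
Qed.

Lemma tent_itv x : 0 <= tent x <= 2.
Proof. by rewrite /tent le_max lexx/= ge_max ler0n/= gerBl. Qed.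

Lemma tent_lipschitz x y : `|tent x - tent y| <= `|x - y|.
Proof.
have h : `| `|x - 2| - `|y - 2| | <= `|x - y|.
  by rewrite (le_trans (ler_dist_dist _ _))// opprB addrA subrK.
move: h; rewrite !ler_norml /tent; set d := `|x - y|.
set a := `|x - 2|; set b := `|y - 2| => /andP[h1 h2].
have d0 : 0 <= d by exact: normr_ge0.
by case: (leP 0 (2 - a)); case: (leP 0 (2 - b)) => *; apply/andP; split; lra.
Qed.

Lemma measurable_tent : measurable_fun setT (tent : TR -> TR).
Proof.
apply: measurable_maxr => //; apply: measurable_funB => //.
by apply: measurableT_comp => //; exact: measurable_funB.
Qed.

Variables (p : R).
Hypothesis p0 : 0 < p.

Let dtent (z y : R) := (`|tent y - tent (y - z)| `^ p)%:E.

Let dtent_ge0 z : (0 <= dtent z.1 z.2)%E.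
Proof. by rewrite lee_fin powR_ge0. Qed.

Let measurable_dtent : measurable_fun setT (fun z : TR * TR => dtent z.1 z.2).
Proof.
apply/measurable_EFinP; apply: (measurableT_comp (measurable_powabs p)).
apply: measurable_funB; first exact: (measurableT_comp measurable_tent measurable_snd).
apply: (measurableT_comp measurable_tent).
by apply: measurable_funB; [exact: measurable_snd|exact: measurable_fst].
Qed.

Let measurable_dtent1 z : measurable_fun setT (dtent z : TR -> \bar R).
Proof. exact: (measurableT_comp measurable_dtent (measurable_pair1 z)). Qed.

(** The difference is at most min(2, |z|), and it is supported by two intervals of
    length 4. *)
Lemma integral_dtent_le (z : R) :
  (\int[leb]_y dtent z y <= (2 `^ p * 8 * Num.min 1 (`|z| `^ p))%:E)%E.
Proof.
pose c := 2 `^ p * Num.min 1 (`|z| `^ p).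
have c0 : 0 <= c by rewrite mulr_ge0 ?powR_ge0// le_min ler01 powR_ge0.
pose I := (`[0, 4]%classic : set TR).
pose J := (`[z, z + 4]%classic : set TR).
have mI : measurable I by exact: measurable_itv.
have mJ : measurable J by exact: measurable_itv.
apply: (@le_trans _ _ (\int[leb]_y (c%:E * ((\1_I y)%:E + (\1_J y)%:E)))%E).
  apply: ge0_le_integral => //.
  - by move=> y _; exact: (dtent_ge0 (z, y)).
  - apply: measurable_funeM; apply: emeasurable_funD; apply/measurable_EFinP;
      exact: measurable_indic.
  - move=> y _; rewrite -EFinD -EFinM lee_fin !indicE !mem_setE !in_itv/=.
    have le_c : `|tent y - tent (y - z)| `^ p <= c.
      have d2 : `|tent y - tent (y - z)| <= 2.
        have /andP[? ?] := tent_itv y; have /andP[? ?] := tent_itv (y - z).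
        by rewrite ler_norml; apply/andP; split; lra.
      have dz : `|tent y - tent (y - z)| <= `|z|.
        by rewrite (le_trans (tent_lipschitz _ _))// opprB addrC subrK.
      have z0 : 0 <= `|z| by exact: normr_ge0.
      have h1 : (1 : R) `^ p = 1 by rewrite powR1.
      rewrite /c; have [z1|z1] := leP 1 `|z|.
        rewrite min_l ?mulr1; last first.
          by rewrite -[leLHS]h1 ge0_ler_powR ?nnegrE// ltW.
        by apply: ge0_ler_powR; rewrite ?nnegrE//; exact: ltW.
      rewrite min_r; last first.
        by rewrite -[leRHS]h1 ge0_ler_powR ?nnegrE// ltW.
      rewrite -powRM//; apply: ge0_ler_powR; rewrite ?nnegrE ?mulr_ge0//; first exact: ltW.
      lra.
    have [yI|yI] := boolP (0 <= y <= 4); have [yJ|yJ] := boolP (z <= y <= z + 4).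
    + by rewrite (le_trans le_c)// ler_peMr// lerDl.
    + by rewrite addr0 mulr1.
    + by rewrite add0r mulr1.
    + rewrite !tent_out//; last first.
        by move: yJ; apply: contra => /andP[? ?]; apply/andP; split; lra.
      by rewrite subrr normr0 powR0 ?gt_eqF// addr0 mulr0.
rewrite ge0_integralZl//; last 2 first.
- by apply: emeasurable_funD; apply/measurable_EFinP; exact: measurable_indic.
- by move=> y _; rewrite -EFinD lee_fin.
rewrite ge0_integralD//; last 2 first.
- by apply/measurable_EFinP; exact: measurable_indic.
- by apply/measurable_EFinP; exact: measurable_indic.
have itvE (x : R) : (\int[leb]_y (\1_(`[x, (x + 4)%R]%classic : set TR) y)%:E)%E = (4 : R)%:E.
  rewrite integral_indic//.
  rewrite setIT [LHS](lebesgue_measure_itv `[x, x + 4])/= lte_fin ltrDl ltr0n -EFinD.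
  by rewrite addrC addKr.
rewrite itvE; have := itvE 0; rewrite add0r -/I => ->.
rewrite -EFinD -EFinM lee_fin /c (_ : 4 + 4 = 8 :> R); last by ring.
by rewrite mulrAC.
Qed.

Let W (z : R) : R := fine (\int[leb]_y dtent z y).

Let int_ge0 z : (0 <= \int[leb]_y dtent z y)%E.
Proof. by apply: integral_ge0 => y _; exact: (dtent_ge0 (z, y)). Qed.

Let WE z : (\int[leb]_y dtent z y = (W z)%:E)%E.
Proof.
rewrite /W fineK// ge0_fin_numE//.
exact: (le_lt_trans (integral_dtent_le z) (ltry _)).
Qed.

Let measurable_W : measurable_fun setT (W : TR -> R).
Proof.
apply/measurable_EFinP; rewrite (_ : EFin \o _ = fun z => (\int[leb]_y dtent z y)%E).
  exact: (@measurable_fun_fubini_tonelli_F _ _ _ _ _ leb _ measurable_dtent dtent_ge0).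
by apply/funext => z /=; rewrite WE.
Qed.

Let W12 z : 1 <= z <= 2 -> 0 < W z.
Proof.
move=> /andP[z1 z2]; rewrite -lte_fin -WE; apply: integral_gt0_on12 => //.
  by move=> y; exact: (dtent_ge0 (z, y)).
move=> y /andP[y1 y2]; rewrite lte_fin powR_gt0// normr_gt0 subr_eq0.
rewrite tent_id ?y2 ?(le_trans _ y1)//.
have [h|h] := boolP (0 <= y - z <= 4).
  rewrite tent_id; first by rewrite -subr_eq0 opprB addrC subrK gt_eqF// (lt_le_trans _ z1).
  by apply/andP; split; lra.
by rewrite tent_out// gt_eqF// (lt_le_trans _ y1).
Qed.

(** For fixed l the substitution of y for l (y - a) gives W (l (b - a)) / |l|, where
    W z is the p-th power of the L_p distance between the tent and its translate
    by z. Then [scale_average] applies to W, which is O(min(1, |z|^p)). *)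
Lemma tent_kernel (q : R) : 0 < q -> q < p ->
  exists2 K : R, 0 < K & forall a b : R,
    (\int[leb]_l \int[leb]_y (`|tent (l * (y - a)) - tent (l * (y - b))| `^ p * `|l| `^ (- q))%:E
     = (K * `|a - b| `^ q)%:E)%E.
Proof.
move=> q0 qp.
have WC z : 0 <= W z <= 2 `^ p * 8 * Num.min 1 (`|z| `^ p).
  by rewrite fine_ge0//= -lee_fin -WE integral_dtent_le.
have [K K0 HK] := scale_average q0 qp measurable_W WC W12.
exists K => // a b; rewrite -normrN opprB -HK; apply: eq_integral => l _.
have [->|l0] := eqVneq l 0.
  rewrite normr0 !powR0 ?oppr_eq0 ?gt_eqF ?addr_gt0// mulr0.
  by under eq_integral do rewrite mulr0; rewrite integral0.
have n0 : 0 < `|l| by rewrite normr_gt0.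
under eq_integral do rewrite EFinM.
have mA : measurable_fun setT (fun y : TR => dtent ((b - a) * l) (l * y + (- (l * a)))).
  exact: (measurableT_comp (measurable_dtent1 _) (measurable_affine l (- (l * a)))).
rewrite (eq_integral (fun y : TR => (`|l| `^ (- q))%:E * dtent ((b - a) * l) (l * y + (-
  (l * a))))%E); last first.
  move=> y _; rewrite muleC /dtent; congr (_ * _ `^ _)%:E.
  by congr (`| tent _ - tent _ |); ring.
rewrite ge0_integralZl//; last by move=> y _; exact: (dtent_ge0 (_, _)).
rewrite (integral_affine (- (l * a)) l0 (measurable_dtent1 _)); last first.
  by move=> y; exact: (dtent_ge0 (_, y)).
rewrite WE -!EFinM; congr EFin.
rewrite mulrA [RHS]mulrC; congr (_ * _).
rewrite -(powR_inv1 (normr_ge0 l)) -powRD; last by rewrite (gt_eqF n0) implybT.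
by rewrite opprD addrC.
Qed.

End kernel.

(** * Embedding snowflakes of L_p, for functions *)

Section space.
Context {R : realType}.
Local Notation leb := (@lebesgue_measure R).
Local Notation TR := (measurableTypeR R).
Local Notation mu := (lebesgue01 R).

(** The even digits are kept, and the two halves of the odd digits are carried to
    the line by [line_from_unit]. *)
Lemma space_from_unit : exists l y w : TR -> TR,
  [/\ measurable_fun setT l, measurable_fun setT y, measurable_fun setT w,
    forall x, 0 < w x &
    forall G : TR * (TR * TR) -> \bar R, measurable_fun setT G -> (forall z, 0 <= G z)%E ->
    (\int[mu]_v (G (even_digits v, (l v, y v)) * (w v)%:E)
     = \int[mu]_x \int[leb]_a \int[leb]_b G (x, (a, b)))%E].
Proof.
have [tau [w [mtau mw w0 H]]] := @line_from_unit R.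
have mev : measurable_fun setT (even_digits : TR -> TR) by exact: measurable_even_digits.
have modd : measurable_fun setT (odd_digits : TR -> TR) by exact: measurable_odd_digits.
pose e x : TR := even_digits (odd_digits x).
pose o x : TR := odd_digits (odd_digits x).
have me : measurable_fun setT e by exact: (measurableT_comp mev modd).
have mo : measurable_fun setT o by exact: (measurableT_comp modd modd).
exists (tau \o e), (tau \o o), (fun v => w (e v) * w (o v)); split.
- exact: measurableT_comp.
- exact: measurableT_comp.
- by apply: measurable_funM; exact: measurableT_comp.
- by move=> x; rewrite mulr_gt0.
move=> G mG G0.
have w0' x : (0 <= (w x)%:E)%E by rewrite lee_fin ltW.
pose G2 (x a b : TR) := (G (x, (tau a, tau b)) * (w b)%:E * (w a)%:E)%E.
have G20 x a b : (0 <= G2 x a b)%E by rewrite /G2 !mule_ge0.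
have mG2 : measurable_fun setT (fun z : TR * (TR * TR) => G2 z.1 z.2.1 z.2.2).
  have m1 : measurable_fun setT (fun z : TR * (TR * TR) => z.2.1).
    exact: (measurableT_comp measurable_fst measurable_snd).
  have m2 : measurable_fun setT (fun z : TR * (TR * TR) => z.2.2).
    exact: (measurableT_comp measurable_snd measurable_snd).
  apply: emeasurable_funM.
    apply: emeasurable_funM; last by apply/measurable_EFinP; exact: measurableT_comp.
    apply: (measurableT_comp mG); apply: measurable_fun_pair; first exact: measurable_fst.
    by apply: measurable_fun_pair; exact: measurableT_comp.
  by apply/measurable_EFinP; exact: measurableT_comp.
rewrite (eq_integral (fun v : TR => (fun z : TR * TR => G2 z.1 (even_digits z.2) (odd_digits z.2))
    (even_digits v, odd_digits v))); last first.
  by move=> v _; rewrite /G2/= EFinM muleA muleAC.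
pose G3 (z : TR * TR) := G2 z.1 (even_digits z.2) (odd_digits z.2).
have mG3 : measurable_fun setT G3.
  have mp : measurable_fun setT (fun z : TR * TR => (z.1, (even_digits z.2,
    odd_digits z.2)) : TR * (TR * TR)).
    apply: measurable_fun_pair; first exact: measurable_fst.
    apply: measurable_fun_pair; first exact: (measurableT_comp mev measurable_snd).
    exact: (measurableT_comp modd measurable_snd).
  exact: (measurableT_comp mG2 mp).
rewrite (integral_digits mG3 (fun z => G20 _ _ _)).
apply: eq_integral => x _ /=.
have mG2x : measurable_fun setT (fun z : TR * TR => G2 x z.1 z.2).
  exact: (measurableT_comp mG2 (measurable_pair1 x)).
rewrite (integral_digits mG2x (fun z => G20 _ _ _)).
have mGx : measurable_fun setT (fun z : TR * TR => G (x, z)).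
  exact: (measurableT_comp mG (measurable_pair1 x)).
rewrite [RHS]H; first last.
- by move=> a; apply: integral_ge0.
- exact: (@measurable_fun_fubini_tonelli_F _ _ _ _ _ leb _ mGx (fun z => G0 (x, z))).
apply: eq_integral => a _.
have mGxa : measurable_fun setT (fun b : TR => G (x, (tau a, b))).
  exact: (measurableT_comp mGx (measurable_pair1 (tau a))).
rewrite /G2 /= ge0_integralZr//; last first.
- by move=> b _; rewrite mule_ge0.
- apply: emeasurable_funM; last exact/measurable_EFinP.
  exact: (measurableT_comp mGxa).
by rewrite [in RHS]H.
Qed.

(** The values of the stable process at the even digits are sent into the kernel
    over the plane of (l, y), which the odd digits provide. The weight of the
    kernel and the density w enter the function through their p-th root, and k
    normalises the constants. *)
Lemma snowflake_map (p s : R) : 0 < p -> p < 2 -> 0 < s -> s < 1 ->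
  exists Psi : (TR -> R) -> TR -> R,
  (forall f, in_Lp p f -> in_Lp p (Psi f)) /\
  forall f g, in_Lp p f -> in_Lp p g ->
    (\int[mu]_x (`|Psi f x - Psi g x| `^ p)%:E =
     (fine (\int[mu]_t (`|f t - g t| `^ p)%:E) `^ s)%:E)%E.
Proof.
move=> p0 p2 s0 s1.
pose q := p * s.
have q0 : 0 < q by rewrite mulr_gt0.
have qp : q < p by rewrite /q gtr_pMr.
have [Th [C C0 [mTh HTh]]] := stable_moments p0 p2 q0 qp.
have [K K0 HK] := tent_kernel p0 q0 qp.
have [l [y [w [ml my mw w0 Hs]]]] := space_from_unit.
pose k := (K * C) `^ (- p^-1).
have kp : k `^ p = (K * C)^-1.
  by rewrite /k -powRrM mulNr mulVf ?gt_eqF// powR_inv1// mulr_ge0// ltW.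
pose Psi0 f v := k * tent (l v * (y v - Th f (even_digits v))) *
   (`|l v| `^ (- q) * w v) `^ p^-1.
(* Psi0 f itself need not be in L_p *)
pose Psi f v := Psi0 f v - Psi0 (cst 0) v.
have mev : measurable_fun setT (even_digits : TR -> TR) by exact: measurable_even_digits.
have mPsi0 f : in_Lp p f -> measurable_fun setT (Psi0 f).
  move=> Lf; apply: measurable_funM.
    apply: measurable_funM => //; apply: (measurableT_comp measurable_tent).
    apply: measurable_funM => //; apply: measurable_funB => //.
    exact: (measurableT_comp (mTh _ Lf) mev).
  apply: (measurableT_comp (measurable_powR p^-1)).
  by apply: measurable_funM => //; exact: (measurableT_comp (measurable_powabs (- q)) ml).
have HPsi f g : in_Lp p f -> in_Lp p g ->
    (\int[mu]_x (`|Psi0 f x - Psi0 g x| `^ p)%:E =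
     (fine (\int[mu]_t (`|f t - g t| `^ p)%:E) `^ s)%:E)%E.
  move=> Lf Lg.
  pose G (z : TR * (TR * TR)) := ((k `^ p)%:E * (`|tent (z.2.1 * (z.2.2 - Th f z.1)) -
     tent (z.2.1 * (z.2.2 - Th g z.1))| `^ p * `|z.2.1| `^ (- q))%:E)%E.
  have G1 (z : TR * (TR * TR)) : (0 <= (`|tent (z.2.1 * (z.2.2 - Th f z.1)) -
     tent (z.2.1 * (z.2.2 - Th g z.1))| `^ p * `|z.2.1| `^ (- q))%:E)%E.
    by rewrite lee_fin mulr_ge0 ?powR_ge0.
  have G0 z : (0 <= G z)%E by rewrite mule_ge0// lee_fin powR_ge0.
  have m1 : measurable_fun setT (fun z : TR * (TR * TR) => z.2.1).
    exact: (measurableT_comp measurable_fst measurable_snd).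
  have m2 : measurable_fun setT (fun z : TR * (TR * TR) => z.2.2).
    exact: (measurableT_comp measurable_snd measurable_snd).
  have mtent h : in_Lp p h -> measurable_fun setT
      (fun z : TR * (TR * TR) => tent (z.2.1 * (z.2.2 - Th h z.1))).
    move=> Lh; apply: (measurableT_comp measurable_tent).
    apply: measurable_funM => //; apply: measurable_funB => //.
    exact: (measurableT_comp (mTh _ Lh) measurable_fst).
  have mG1 : measurable_fun setT (fun z : TR * (TR * TR) =>
      (`|tent (z.2.1 * (z.2.2 - Th f z.1)) -
      tent (z.2.1 * (z.2.2 - Th g z.1))| `^ p * `|z.2.1| `^ (- q))%:E).
    apply/measurable_EFinP; apply: measurable_funM.
      apply: (measurableT_comp (measurable_powabs p)).
      by apply: measurable_funB; exact: mtent.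
    exact: (measurableT_comp (measurable_powabs (- q)) m1).
  have mG : measurable_fun setT G by exact: measurable_funeM.
  rewrite (eq_integral (fun v : TR => G (even_digits v, (l v, y v)) * (w v)%:E)%E); last first.
    move=> v _; rewrite /G /= -!EFinM; congr EFin.
    have rho0 : 0 <= `|l v| `^ (- q) * w v by rewrite mulr_ge0 ?powR_ge0// ltW.
    rewrite /Psi0 -mulrBl -mulrBr !normrM [LHS]powRM ?mulr_ge0// [X in X * _]powRM//.
    rewrite [X in _ * X `^ p]ger0_norm ?powR_ge0// -powRrM mulVf ?gt_eqF// powRr1//.
    by rewrite [`|k|]ger0_norm ?powR_ge0// !mulrA.
  rewrite (Hs _ mG G0) /G /=.
  transitivity (\int[mu]_x ((k `^ p * K)%:E * (`|Th f x - Th g x| `^ q)%:E))%E.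
    apply: eq_integral => x _; rewrite -[in RHS]EFinM -mulrA EFinM -HK.
    have mGx : measurable_fun setT (fun z : TR * TR =>
      (`|tent (z.1 * (z.2 - Th f x)) - tent (z.1 * (z.2 - Th g x))| `^ p * `|z.1| `^ (- q))%:E).
      exact: (measurableT_comp mG1 (measurable_pair1 x)).
    rewrite -ge0_integralZl//; last first.
    - by rewrite lee_fin powR_ge0.
    - by move=> a _; apply: integral_ge0 => b _; exact: (G1 (x, (a, b))).
    - exact: (@measurable_fun_fubini_tonelli_F _ _ _ _ _ leb _ mGx (fun z => G1 (x, z))).
    apply: eq_integral => a _; rewrite ge0_integralZl//; last first.
    - by rewrite lee_fin powR_ge0.
    - exact: (measurableT_comp mGx (measurable_pair1 a)).
  rewrite ge0_integralZl//; last first.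
  - by rewrite lee_fin mulr_ge0 ?powR_ge0// ltW.
  - apply/measurable_EFinP; apply: (measurableT_comp (measurable_powabs q)).
    by apply: measurable_funB; exact: mTh.
  rewrite HTh// -EFinM kp /q [p * s]mulrC mulfK ?gt_eqF//; congr EFin.
  by field; rewrite !gt_eqF.
have L0 : in_Lp p (cst 0) by exact: in_Lp0.
exists Psi; split => [f Lf|f g Lf Lg].
  split; first by apply: measurable_funB; exact: mPsi0.
  by rewrite HPsi// ltry.
rewrite -(HPsi _ _ Lf Lg); apply: eq_integral => x _; rewrite /Psi.
by rewrite opprB addrA subrK.
Qed.

End space.

(** * Passage to classes of functions *)

Section classes.
Context {R : realType}.
Local Notation TR := (measurableTypeR R).
Local Notation mu := (lebesgue01 R).

Lemma measurable_class (f : {mfun_ mu, TR >-> TR}) : measurable_fun setT (f : TR -> R).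
Proof. exact: (@measurable_funPT _ _ _ _ (repr f)). Qed.

Lemma class_of (h : TR -> R) : measurable_fun setT h ->
  exists f : {mfun_ mu, TR >-> TR}, (f : TR -> R) = h %[ae mu].
Proof.
move=> mh; pose H : {mfun TR >-> TR} := HB.pack h (isMeasurableFun.Build _ _ TR TR h mh).
exists (\pi_({mfun_ mu, TR >-> TR}) H)%qT.
by have /eqmodP/asboolP := reprK (\pi_({mfun_ mu, TR >-> TR}) H)%qT.
Qed.

(** The image class is that of the image of the canonical representative; choosing
    another representative changes it on a null set, which integrals ignore. *)
Lemma snowflake_class (p s : R) : 0 < p -> p < 2 -> 0 < s -> s < 1 ->
  exists Psi : {mfun_ mu, TR >-> TR} -> {mfun_ mu, TR >-> TR},
  (forall f : {mfun_ mu, TR >-> TR}, in_Lp p f -> in_Lp p (Psi f)) /\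
  forall f g : {mfun_ mu, TR >-> TR}, in_Lp p f -> in_Lp p g ->
    (\int[mu]_x (`|Psi f x - Psi g x| `^ p)%:E =
     (fine (\int[mu]_t (`|f t - g t| `^ p)%:E) `^ s)%:E)%E.
Proof.
move=> p0 p2 s0 s1; have [Psi [LPsi HPsi]] := snowflake_map p0 p2 s0 s1.
have cl (f : {mfun_ mu, TR >-> TR}) : exists F : {mfun_ mu, TR >-> TR},
    in_Lp p f -> (F : TR -> R) = Psi f %[ae mu].
  have [Lf|nLf] := pselect (in_Lp p f); last by exists f.
  by have [mPf _] := LPsi _ Lf; have [F HF] := class_of mPf; exists F.
have [Phi HPhi] := choice cl.
have mpow (h : TR -> R) : measurable_fun setT h ->
    measurable_fun setT (fun x : TR => (`|h x| `^ p)%:E).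
  move=> mh; apply/measurable_EFinP.
  exact: (measurableT_comp (measurable_powabs p) mh).
exists Phi; split => [f Lf|f g Lf Lg].
  have mPhi := measurable_class (Phi f); have [mPsi LP] := LPsi _ Lf.
  split; first exact: mPhi.
  have -> : (\int[mu]_t (`|Phi f t| `^ p)%:E = \int[mu]_t (`|Psi f t| `^ p)%:E)%E; last exact: LP.
  apply: ge0_ae_eq_integral => //; [exact: mpow|exact: mpow|..].
  by apply: filterS (HPhi _ Lf) => x /= -> .
have [mf _] := LPsi _ Lf; have [mg _] := LPsi _ Lg.
have mF := measurable_class (Phi f); have mG := measurable_class (Phi g).
rewrite -(HPsi _ _ Lf Lg); apply: ge0_ae_eq_integral => //.
- by apply: mpow; exact: measurable_funB.
- by apply: mpow; exact: measurable_funB.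
- by apply: filterS2 (HPhi _ Lf) (HPhi _ Lg) => x /= -> // ->.
Qed.

Section norm.
Variables (p : R) (p1 : (1 <= p%:E)%E).

Let p0 : 0 < p.
Proof. by rewrite (lt_le_trans ltr01)// -lee_fin. Qed.

Lemma Lnorm_powR (h : TR -> R) :
  ('N[mu]_(p%:E) [EFin \o h] = (\int[mu]_x (`|h x| `^ p)%:E) `^ p^-1)%E.
Proof. by rewrite unlock /=. Qed.

Lemma in_Lp_Lspace (f : LspaceType mu p1) : in_Lp p f.
Proof.
split; first exact: measurable_class.
have := @Lebesgue_finite _ _ _ _ _ _ f; rewrite /finite_norm Lnorm_powR.
by apply: lty_poweRy; rewrite invr_eq0 gt_eqF.
Qed.

Lemma Lspace_of (f : {mfun_ mu, TR >-> TR}) : in_Lp p f ->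
  exists F : LspaceType mu p1, (F : {mfun_ mu, TR >-> TR}) = f.
Proof.
move=> [_ Lf].
have fin : finite_norm mu p%:E f by rewrite /finite_norm Lnorm_powR poweR_lty.
pose H := isFinLebesgue.Build _ TR R mu p%:E p1 f fin.
pose F : LspaceType mu p1 := HB.pack f H.
by exists F.
Qed.

Lemma Lnorm_distE (f g : LspaceType mu p1) :
  Lnorm_dist mu p1 f g = fine (\int[mu]_x (`|f x - g x| `^ p)%:E)%E `^ p^-1.
Proof.
have [_ Lfg] := in_LpB p0 (in_Lp_Lspace f) (in_Lp_Lspace g).
rewrite /Lnorm_dist Lnorm_powR -[X in (X `^ _)%E]fineK//.
by rewrite ge0_fin_numE// integral_ge0// => x _; rewrite lee_fin powR_ge0.
Qed.

Lemma Lspace_snowflake (s : R) : p < 2 -> 0 < s -> s < 1 ->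
  embeds_isometrically (snowflake (Lnorm_dist mu p1) s) (Lnorm_dist mu p1).
Proof.
move=> p2 s0 s1; have [Psi [LPsi HPsi]] := snowflake_class p0 p2 s0 s1.
have [h Hh] := choice (fun f : LspaceType mu p1 => Lspace_of (LPsi f (in_Lp_Lspace f))).
exists h => f g; rewrite /snowflake !Lnorm_distE !Hh HPsi; try exact: in_Lp_Lspace.
by rewrite -!powRrM mulrC.
Qed.

End norm.

Lemma Lp_lt1_snowflake (p s : R) : 0 < p -> p < 2 -> 0 < s -> s < 1 ->
  embeds_isometrically (snowflake (Lp_dist mu p) s) (Lp_dist mu p).
Proof.
move=> p0 p2 s0 s1; have [Psi [LPsi HPsi]] := snowflake_class p0 p2 s0 s1.
have Lval (f : @Lp_lt1 _ TR R mu p) : in_Lp p (val f).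
  by split; [exact: measurable_class|exact: set_mem (valP f)].
have mPsi (f : @Lp_lt1 _ TR R mu p) : Psi (val f) \in @Lp_lt1 _ TR R mu p
  by apply: mem_set; case: (LPsi _ (Lval f)).
exists (fun f => SigSub (mPsi f)) => f g.
by rewrite /snowflake /Lp_dist /Rintegral HPsi.
Qed.

End classes.

Theorem proposition5p4 (R : realType) :
  [/\ (forall (p s : R) (p1 : (1 <= p%:E)%E),
         p < 2 -> p / 2 <= s -> s < 1 ->
         embeds_isometrically
           (snowflake (Lnorm_dist (lebesgue01 R) p1) s)
           (Lnorm_dist (lebesgue01 R) p1)),
      (forall s : R, 0 < s -> s < 1 ->
         embeds_isometrically
           (snowflake (Lnorm_dist (lebesgue01 R) (lexx 1%:E)) s)
           (Lnorm_dist (lebesgue01 R) (lexx 1%:E)))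
    & (forall p s : R, 0 < p -> p < 1 -> 0 < s -> s < 1 ->
         embeds_isometrically
           (snowflake (Lp_dist (lebesgue01 R) p) s)
           (Lp_dist (lebesgue01 R) p))].
Proof.
split => [p s p1 p2 ps s1|s s0 s1|p s p0 p1 s0 s1].
- apply: Lspace_snowflake => //; apply: lt_le_trans ps.
  by rewrite divr_gt0// (lt_le_trans ltr01)// -lee_fin.
- by apply: Lspace_snowflake => //; rewrite ltr1n.
- by apply: Lp_lt1_snowflake => //; rewrite (lt_trans p1)// ltr1n.
Qed.
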